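(* Work in the setting of the context. Assume that $h:\mathbb{R}^2\times\mathbb{R}^2\to\mathbb{R}$ is Lipschitz continuous with Lipschitz constant $L>0$ and symmetric, i.e. $h(w,w')=h(w',w)$ for all $w,w'\in\mathbb{R}^2$. Then $$\mathbb{E}\Big[\sup_{g\in\mathcal{G}}\big(T_n(g)-\mathbb{E}[T_n(g)]\big)\Big]\ \lesssim_L\ \frac{1}{n}\,\mathbb{E}\left[\sup_{g\in\mathcal{G}}\sum_{i=1}^n\sqrt{1+\frac{d_i}{k_n}}\;Z_i\,g(\eta_i,x_i)\right],$$ where, for all $i\in[n]$, $d_i$ is the degree (in-degree plus out-degree) of the vertex $x_i$ in $G(\mathscr{X}_n)$, and $Z_1,\dots,Z_n$ are generated independently from $N(0,1)$.
   Context: Let $n\ge2$, $d,m\ge1$, let $\mathscr{X}_n=\{x_1,\dots,x_n\}$ be a collection of $n$ points in $\mathbb{R}^d$, and let $G(\mathscr{X}_n)$ be the directed $k_n$-nearest-neighbor graph on $\mathscr{X}_n$ with respect to $\|\cdot\|_2$ (an edge $x_i\to x_j$ means that $x_j$ is one of the $k_n$ nearest neighbors of $x_i$). Put $N(i)=\{j\in[n]:x_i\to x_j\text{ is a directed edge in }G(\mathscr{X}_n)\}$, where $[n]=\{1,\dots,n\}$. $\mathcal{G}$ is a collection of functions $g:\mathbb{R}^m\times\mathbb{R}^d\to\mathbb{R}$, and $(\eta_1,Y_1),\dots,(\eta_n,Y_n)$ are i.i.d. random elements of $\mathbb{R}^m\times\mathbb{R}$. For $g\in\mathcal{G}$ put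 $W_{i,g}:=(Y_i,g(\eta_i,x_i))\in\mathbb{R}^2$ and $$T_n(g):=\frac1{nk_n}\sum_{i=1}^n\sum_{j\in N(i)}h(W_{i,g},W_{j,g}).$$ $a\lesssim_L b$ means $a\le C_L b$ for some constant $C_L>0$ depending on $L$.
   Formalization: The constant may depend on d as well as L (with L alone the claim fails, e.g. star configurations with d=n-1); the points are distinct, and measurability, integrability of g and h, and separability of the process over G are assumed so the expectations make sense. *)

(* Defs.v *)
From HB Require Import structures.
From mathcomp Require Import all_boot all_order all_algebra.
From mathcomp Require Import all_classical all_reals all_analysis.

Set Implicit Arguments.
Unset Strict Implicit.
Unset Printing Implicit Defensive.

Import Order.TTheory GRing.Theory Num.Theory.
Import numFieldNormedType.Exports.

Local Open Scope classical_set_scope.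
Local Open Scope ring_scope.

(* The norm of MathComp-Analysis on row vectors and on products is the sup
   norm, so Euclidean distances are written out. *)
Definition edist (R : realType) (d : nat) (x y : 'rV[R]_d) : R :=
  Num.sqrt (\sum_(c < d) (x ord0 c - y ord0 c) ^+ 2).

(* Lipschitz for the Euclidean norm of (R^2) x (R^2) = R^4. *)
Definition lipschitz_kernel (R : realType) (L : R) (h : R * R -> R * R -> R) :=
  forall w1 w2 v1 v2 : R * R,
    `|h w1 w2 - h v1 v2| <=
      L * Num.sqrt ((w1.1 - v1.1) ^+ 2 + (w1.2 - v1.2) ^+ 2 +
                    (w2.1 - v2.1) ^+ 2 + (w2.2 - v2.2) ^+ 2).

(* [N i] is the set of out-neighbours of the vertex [i].  Equal distances are
   broken arbitrarily: any choice of exactly k nearest neighbours of each point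
   (the point itself excluded) is allowed. *)
Definition knn_graph (R : realType) (n d k : nat) (x : 'I_n -> 'rV[R]_d)
    (N : 'I_n -> {set 'I_n}) :=
  forall i : 'I_n,
    [/\ i \notin N i, #|N i| = k &
        forall j l : 'I_n, j \in N i -> l \notin N i -> l != i ->
          edist (x i) (x j) <= edist (x i) (x l)].

Definition degree (n : nat) (N : 'I_n -> {set 'I_n}) (i : 'I_n) : nat :=
  (#|N i| + #|[set j | i \in N j]%SET|)%N.

Definition independent_systems d (Omega : measurableType d) (R : realType)
    (P : probability Omega R) (I : finType) (F : I -> set (set Omega)) :=
  forall (J : {set I}) (E : I -> set Omega),
    (forall i, i \in J -> F i (E i)) ->
    P (\bigcap_(i in [set` J]) E i) = (\prod_(i in J) P (E i))%E.

Definition events_of d d' (Omega : measurableType d) (T : measurableType d')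
    (X : Omega -> T) : set (set Omega) :=
  preimage_set_system setT X measurable.

Definition sup_process (R : realType) (Omega A : Type) (G : set A)
    (X : A -> Omega -> R) (w : Omega) : \bar R :=
  ereal_sup [set (X g w)%:E | g in G].

(* The usual (Doob) separability, which makes the supremum of an uncountable
   family almost surely equal to a measurable function; it is automatic when
   G is countable. *)
Definition separable_process d (Omega : measurableType d) (R : realType)
    (P : probability Omega R) (A : Type) (G : set A) (X : A -> Omega -> R) :=
  exists G0 : set A,
    [/\ countable G0, G0 `<=` G &
        {ae P, forall w, sup_process G X w = sup_process G0 X w}].

Section graph_statistic.
Context (R : realType) (n m d k : nat) (Omega : Type).
(* R^m is [m.-tuple R], which carries the product (= Borel) sigma-algebra;
   [V i] is the pair (eta_i, Y_i). *)
Variables (h : R * R -> R * R -> R) (x : 'I_n -> 'rV[R]_d)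
  (N : 'I_n -> {set 'I_n}) (V : 'I_n -> Omega -> m.-tuple R * R).

Definition Wpair (g : m.-tuple R -> 'rV[R]_d -> R) (i : 'I_n) (w : Omega) :
  R * R := ((V i w).2, g (V i w).1 (x i)).

Definition Tstat (g : m.-tuple R -> 'rV[R]_d -> R) (w : Omega) : R :=
  (n%:R * k%:R)^-1 *
    \sum_(i < n) \sum_(j in N i) h (Wpair g i w) (Wpair g j w).

Definition gauss_process (Z : 'I_n -> Omega -> R)
    (g : m.-tuple R -> 'rV[R]_d -> R) (w : Omega) : R :=
  \sum_(i < n) Num.sqrt (1 + (degree N i)%:R / k%:R) * Z i w
                 * g (V i w).1 (x i).

End graph_statistic.

(* Only used for integrable statistics, so that [fine] is harmless. *)
Definition centered_stat d' (Omega : measurableType d') (R : realType)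
    (P : probability Omega R) (A : Type) (T : A -> Omega -> R)
    (g : A) (w : Omega) : R :=
  T g w - fine 'E_P[T g].

(* Main.v *)
Require Import Defs.
From HB Require Import structures.
From mathcomp Require Import all_boot all_order all_algebra.
From mathcomp Require Import all_classical all_reals all_analysis.
From mathcomp Require Import measurable_realfun ring lra.

Set Implicit Arguments.
Unset Strict Implicit.
Unset Printing Implicit Defensive.

Import Order.TTheory GRing.Theory Num.Theory.
Import numFieldNormedType.Exports.

Local Open Scope classical_set_scope.
Local Open Scope ring_scope.

(* The vertices of the k-NN graph have degree at most a dimensional constant
   times k: within a cone of angle less than 60 degrees at x_i, the farthest point
   having x_i among its k nearest neighbours has all the other such points of the
   cone among its own. Hence the edges split greedily into O(k) matchings. In one
   matching the summands h(W_i, W_j) are functions of independent pairs, so their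
   centered sum can be replaced edge by edge, inside the expectation of the maximum,
   by multiples of Z_i g(eta_i, x_i) + Z_j g(eta_j, x_j). For one edge, with the
   other summands frozen to constants a_l, this is a symmetrization followed by a
   Gaussian contraction, which rests on c * E|Z| * |s - s'| = E|c Z (s - s')| and on
     max_{l,l'} (a_l + a_l' + |u_l - u_l'|) = max_l (a_l + u_l) + max_l (a_l - u_l).
   Adding centered independent noise, or enlarging its scale, increases the
   expected maximum; this completes a matching to all vertices with the weights
   sqrt(1 + d_i / k). Finite families suffice by monotone convergence along the
   countable separating family. *)

(** * Independence of generated sigma-algebras *)

(** Summands that share a vertex are dependent, so they cannot be exchanged one at a time across the
    whole graph; inside a matching they are independent. Passing from the maximum of a sum over
    colours to the sum of the maxima costs one term per colour, and the normalization 1/(n k) can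
    pay for O(k) colours only. This is where the geometry of nearest neighbours is needed, and it
    makes the constant depend on d as well as on L. A vertex meets at most one edge of a matching,
    so a single matching asks for weight at most 1 at each vertex, below sqrt(1 + d_i / k). The
    coordinate Y_i is common to all g, so the Lipschitz bound between two functions g, g' involves
    only the values of g and g' at the two endpoints; only these get multiplied by Gaussians. The
    supremum over G need not be measurable, so the last comparisons rely on monotonicity of the
    integral alone. *)

Section independence.
Context d (Omega : measurableType d) (R : realType) (P : probability Omega R).

Definition sigma_join (I : finType) (F : I -> set (set Omega)) (J : {set I}) :
  set (set Omega) := \bigcup_(s in [set` J]) F s.

(* The pi-system generating [sigma_join F J]. *)
Definition cylinders (I : finType) (F : I -> set (set Omega)) (J : {set I}) :
  set (set Omega) :=
  [set A | exists2 E : I -> set Omega, (forall s, s \in J -> F s (E s)) &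
     A = \bigcap_(s in [set` J]) E s].

(** Both sides are finite measures in A, the restriction of P to B and a multiple of P; they agree
    on the pi-system C, hence on the sigma-algebra it generates. *)
Lemma probability_setI_sigma (C : set (set Omega)) (B : set Omega) :
  C `<=` measurable -> C setT -> setI_closed C -> measurable B ->
  (forall A, C A -> P (A `&` B) = (P A * P B)%E) ->
  forall A, <<s C >> A -> P (A `&` B) = (P A * P B)%E.
Proof.
move=> Cm CT CI mB CB A sA.
have [c cE] : exists c : {nonneg R}, (c%:num)%:E = P B.
  have pB0 : 0 <= fine (P B) by rewrite fine_ge0.
  by exists (NngNum pB0); rewrite /= fineK// fin_num_measure.
rewrite muleC -cE -[LHS]/(mrestr P mB A) -[RHS]/(mscale c P A).
apply: (g_sigma_algebra_measure_unique C Cm (fun=> setT)) => //.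
- by apply/seteqP; split => // x _; exists 0%N.
- by move=> X CX; have := CB _ CX; rewrite muleC -cE; exact.
- move=> _; apply: (@le_lt_trans _ _ (P (setT `&` B))) => //.
  by rewrite setTI (le_lt_trans (probability_le1 P mB))// ltry.
Qed.

Variables (I : finType) (F : I -> set (set Omega)).
Hypothesis Fm : forall s, F s `<=` measurable.
Hypothesis FT : forall s, F s setT.
Hypothesis FI : forall s, setI_closed (F s).
Hypothesis Findep : independent_systems P F.

Lemma sigma_join_measurable (J : {set I}) :
  <<s sigma_join F J >> `<=` measurable.
Proof.
apply: smallest_sub; first exact: sigma_algebra_measurable.
by move=> A [s _ FA]; exact: (Fm FA).
Qed.

Lemma sub_sigma_join (J K : {set I}) : J \subset K ->
  <<s sigma_join F J >> `<=` <<s sigma_join F K >>.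
Proof.
move=> /fintype.subsetP JK; apply: sub_sigma_algebra2 => A [s /= sJ FA].
by exists s => //=; exact: JK.
Qed.

Lemma cylinders_measurable (J : {set I}) : cylinders F J `<=` measurable.
Proof.
move=> A [E FE ->]; apply: fin_bigcap_measurable => // s sJ.
by apply: (@Fm s); exact: FE.
Qed.

Lemma cylindersT (J : {set I}) : cylinders F J setT.
Proof.
exists (fun=> setT) => [s _|]; first exact: FT.
by apply/seteqP; split.
Qed.

Lemma cylindersI (J : {set I}) : setI_closed (cylinders F J).
Proof.
move=> _ _ [E FE ->] [E' FE' ->]; exists (fun s => E s `&` E' s).
  by move=> s sJ; apply: FI; [exact: FE|exact: FE'].
by rewrite bigcapI.
Qed.

Lemma sigma_join_cylinders (J : {set I}) :
  <<s sigma_join F J >> `<=` <<s cylinders F J >>.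
Proof.
apply: sub_sigma_algebra2 => A [s /= sJ FA].
exists (fun t => if t == s then A else setT) => [t tJ|].
  by have [->|_] := eqVneq t s; [|exact: FT].
apply/seteqP; split => [w Aw t _|w /(_ s sJ)]; last by rewrite eqxx.
by case: ifP.
Qed.

Lemma cylinders_indep (J K : {set I}) A B : (forall s, s \in J -> s \notin K) ->
  cylinders F J A -> cylinders F K B -> P (A `&` B) = (P A * P B)%E.
Proof.
move=> dJK [E FE ->] [E' FE' ->].
(* Since J and K are disjoint, one family carries both cylinders, and [Findep] can be applied to J,
   to K and to their union. *)
pose G s := if s \in J then E s else E' s.
have GE s : s \in J -> G s = E s by rewrite /G => ->.
have GE' s : s \in K -> G s = E' s.
  by rewrite /G; case: ifPn => // /dJK /negbTE->.
rewrite -(eq_bigcapr (F := G)) => [|s sJ]; last exact: GE.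
rewrite -(eq_bigcapr (P := [set` K]) (F := G)) => [|s sK]; last exact: GE'.
have -> : \bigcap_(s in [set` J]) G s `&` \bigcap_(s in [set` K]) G s =
          \bigcap_(s in [set` (J :|: K)%SET]) G s.
  apply/seteqP; split => [w [wJ wK] s /=|w wJK].
    by rewrite finset.in_setU => /orP[/wJ|/wK].
  by split => s /= sJ; apply: wJK => /=; rewrite finset.in_setU sJ ?orbT.
rewrite !Findep => [|s sK|s sJ|s].
- rewrite (bigID (mem J))/=; congr (_ * _)%E; apply: eq_bigl => s.
    by rewrite finset.in_setU; case: (s \in J); rewrite ?andbF.
  rewrite finset.in_setU; have := dJK s.
  by case: (s \in J) => [/(_ isT) /negbTE->|_]; rewrite ?andbT.
- by rewrite GE'//; exact: FE'.
- by rewrite GE//; exact: FE.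
- by rewrite finset.in_setU => /orP[sJ|sK]; [rewrite GE//; exact: FE|rewrite GE'//; exact: FE'].
Qed.

(** The pi-system extension is used twice, on one event at a time: cylinders against cylinders, then
    a general A against cylinders, then a general A against a general B. *)
Lemma sigma_join_indep (J K : {set I}) A B : (forall s, s \in J -> s \notin K) ->
  <<s sigma_join F J >> A -> <<s sigma_join F K >> B ->
  P (A `&` B) = (P A * P B)%E.
Proof.
move=> dJK sA sB.
have mA := sigma_join_measurable sA.
rewrite setIC muleC.
apply: (@probability_setI_sigma (cylinders F K)) => //.
- exact: cylinders_measurable.
- exact: cylindersT.
- exact: cylindersI.
- move=> {sB}B cB; rewrite setIC muleC.
  apply: (@probability_setI_sigma (cylinders F J)) => //.
  + exact: cylinders_measurable.
  + exact: cylindersT.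
  + exact: cylindersI.
  + exact: cylinders_measurable cB.
  + by move=> A' cA; exact: cylinders_indep cA cB.
  + exact: sigma_join_cylinders.
- exact: sigma_join_cylinders.
Qed.

End independence.

(** * Iterated integrals for two independent variables *)

Section indep_integral.
Context d d1 d2 (Omega : measurableType d) (T1 : measurableType d1)
  (T2 : measurableType d2) (R : realType) (P : probability Omega R).

Definition indep2 (X : Omega -> T1) (Y : Omega -> T2) :=
  forall A B, measurable A -> measurable B ->
    P (X @^-1` A `&` Y @^-1` B) = (P (X @^-1` A) * P (Y @^-1` B))%E.

Variables (X : {RV P >-> T1}) (Y : {RV P >-> T2}).
Hypothesis XY : indep2 X Y.

Let mpair : measurable_fun setT (fun w => (X w, Y w)).
Proof. exact: measurable_fun_pair. Qed.

Let joint : {RV P >-> (T1 * T2)%type} := mfun_Sub (mem_set mpair).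

Let joint_law A : measurable A ->
  (distribution P X \x distribution P Y)%E A = distribution P joint A.
Proof.
move=> mA.
apply: (@product_measure_unique _ _ _ _ _ (distribution P X) (distribution P Y)
  (distribution P joint)) => //.
Qed.

Let measurable_section1 d' (U : measurableType d') (psi : T1 * T2 -> U) x :
  measurable_fun setT psi -> measurable_fun setT (fun y => psi (x, y)).
Proof. by move=> mpsi; apply: measurableT_comp mpsi _; exact: measurable_fun_pair. Qed.

Lemma indep_ge0_integral (psi : T1 * T2 -> \bar R) :
  measurable_fun setT psi -> (forall z, 0 <= psi z)%E ->
  (\int[P]_w psi (X w, Y w) = \int[P]_w \int[P]_w' psi (X w, Y w'))%E.
Proof.
move=> mpsi psi0.
transitivity (\int[distribution P joint]_z psi z)%E.
  by rewrite ge0_integral_distribution.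
transitivity (\int[distribution P X \x distribution P Y]_z psi z)%E.
  by apply: eq_measure_integral => A mA _; exact/esym/joint_law.
rewrite fubini_tonelli1// ge0_integral_distribution//.
- apply: eq_integral => w _ /=; rewrite /fubini_F ge0_integral_distribution//.
  exact: measurable_section1.
- exact: measurable_fun_fubini_tonelli_F.
- by move=> x; apply: integral_ge0.
Qed.

(** Fubini for the joint law. Integrability of the section is asked at every x, so that the inner
    integral is rewritten over P pointwise and not merely almost everywhere. *)
Lemma indep_integral (psi : T1 * T2 -> R) :
  measurable_fun setT psi ->
  P.-integrable setT (fun w => (psi (X w, Y w))%:E) ->
  (forall x, P.-integrable setT (fun w => (psi (x, Y w))%:E)) ->
  (\int[P]_w (psi (X w, Y w))%:E = \int[P]_w \int[P]_w' (psi (X w, Y w'))%:E)%E.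
Proof.
move=> mpsi ipsi ipsi1.
have mpsiE : measurable_fun setT (EFin \o psi) by exact/measurable_EFinP.
have ijoint : (distribution P joint).-integrable setT (EFin \o psi).
  exact: integrable_pushforward.
transitivity (\int[distribution P joint]_z (psi z)%:E)%E.
  by rewrite integral_distribution.
have elaw : forall A, measurable A -> A `<=` setT ->
    distribution P joint A = (distribution P X \x distribution P Y)%E A.
  by move=> A mA _; exact/esym/joint_law.
have iprod : (distribution P X \x distribution P Y)%E.-integrable setT (EFin \o psi).
  apply/integrableP; split => //; move/integrableP : ijoint => [_].
  by rewrite (eq_measure_integral _ elaw).
transitivity (\int[distribution P X \x distribution P Y]_z (psi z)%:E)%E.
  exact: eq_measure_integral.
have E1 x : (fubini_F (distribution P Y) (EFin \o psi) x = \int[P]_w (psi (x, Y w))%:E)%E.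
  rewrite /fubini_F integral_distribution//; last exact: ipsi1.
  exact: (@measurable_section1 _ _ (EFin \o psi)).
have iF := integrable_fubini_F iprod.
transitivity (\int[distribution P X]_x
    fubini_F (distribution P Y) (EFin \o psi) x)%E.
  exact/esym/integral12_prod_meas1.
rewrite integral_distribution//.
- by apply: eq_integral => w _ /=; rewrite E1.
- exact: (measurable_fubini_F iprod).
- have mF := measurable_fubini_F iprod.
  apply/integrableP; split; first exact: measurableT_comp.
  have /integrableP[_] := iF.
  by rewrite ge0_integral_distribution//; exact: measurableT_comp.
Qed.

End indep_integral.

(** * Finite maxima and expectations *)

Section vmax.
Context (R : realType) (p : nat).
Implicit Types a b : 'I_p.+1 -> R.

(** The index type is inhabited, and the default [a ord0] is itself one of the values, so it never
    affects the maximum. *)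
Definition vmax a : R := \big[Num.max/a ord0]_(i < p.+1) a i.

Lemma le_vmax a i : a i <= vmax a.
Proof. exact: le_bigmax. Qed.

Lemma vmax_le a c : (forall i, a i <= c) -> vmax a <= c.
Proof. by move=> ac; apply: bigmax_le => // i _. Qed.

Lemma vmaxS a b : (forall i, a i <= b i) -> vmax a <= vmax b.
Proof. by move=> ab; apply: vmax_le => i; apply: le_trans (ab i) (le_vmax _ _). Qed.

Lemma eq_vmax a b : a =1 b -> vmax a = vmax b.
Proof. by move=> /funext->. Qed.

Lemma vmaxP a : exists i, vmax a = a i.
Proof.
rewrite /vmax; elim/big_ind: _ => [|x y [i ->] [j ->]|i _]; first by exists ord0.
  by case: (leP (a i) (a j)); [exists j|exists i].
by exists i.
Qed.

Lemma vmaxD a b : vmax (fun i => a i + b i) <= vmax a + vmax b.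
Proof. by apply: vmax_le => i; rewrite lerD// le_vmax. Qed.

Lemma vmaxZ (c : R) a : 0 <= c -> vmax (fun i => c * a i) = c * vmax a.
Proof.
move=> c0; have [i ai] := vmaxP a; apply/eqP; rewrite eq_le; apply/andP; split.
  by apply: vmax_le => j; rewrite ler_wpM2l// le_vmax.
by rewrite ai; exact: (le_vmax (fun i => c * a i)).
Qed.

Lemma vmax_le_sum_norm a : `|vmax a| <= \sum_(i < p.+1) `|a i|.
Proof.
have [i ->] := vmaxP a; rewrite (bigD1 i)//= lerDl.
by apply: sumr_ge0.
Qed.

End vmax.

Section mean.
Context d (Omega : measurableType d) (R : realType) (P : probability Omega R).
Implicit Types X Y : Omega -> R.

Definition itg X := P.-integrable setT (fun w => (X w)%:E).
Definition mean X : R := \int[P]_w X w.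

Lemma itg_mf X : itg X -> measurable_fun setT X.
Proof. by move=> /integrableP[/measurable_EFinP]. Qed.

Lemma meanE X : itg X -> (mean X)%:E = (\int[P]_w (X w)%:E)%E.
Proof. by move=> iX; rewrite fineK//; exact: integrable_fin_num. Qed.

Lemma itg_le X Y : measurable_fun setT X -> itg Y ->
  (forall w, `|X w| <= Y w) -> itg X.
Proof.
move=> mX iY XY; apply: (le_integrable measurableT _ _ iY) => //.
  exact/measurable_EFinP.
move=> w _ /=; rewrite lee_fin (le_trans (XY w))// ler_norm//.
Qed.

Lemma itgD X Y : itg X -> itg Y -> itg (fun w => X w + Y w).
Proof. by move=> iX iY; have := integrableD measurableT iX iY. Qed.

Lemma itgZ (c : R) X : itg X -> itg (fun w => c * X w).
Proof. by move=> iX; have := integrableZl measurableT c iX. Qed.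

Lemma itgN X : itg X -> itg (fun w => - X w).
Proof.
move=> /(itgZ (-1)); congr (P.-integrable _ _).
by apply/funext => w; rewrite mulN1r.
Qed.

Lemma itgB X Y : itg X -> itg Y -> itg (fun w => X w - Y w).
Proof. by move=> iX iY; apply: itgD => //; exact: itgN. Qed.

Lemma itg_cst (c : R) : itg (fun=> c).
Proof. exact: finite_measure_integrable_cst. Qed.

Lemma itg_abs X : itg X -> itg (fun w => `|X w|).
Proof. by move=> iX; have := integrable_abse iX. Qed.

Lemma itg_sum (I : Type) (r : seq I) (S : pred I) (X : I -> Omega -> R) :
  (forall i, S i -> itg (X i)) -> itg (fun w => \sum_(i <- r | S i) X i w).
Proof.
move=> iX; elim: r => [|i r IH].
  by under eq_fun do rewrite big_nil; exact: itg_cst.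
under eq_fun do rewrite big_cons; case Si: (S i) => //.
by apply: itgD => //; exact: iX.
Qed.

Lemma mf_vmax d' (T : measurableType d') p (X : 'I_p.+1 -> T -> R) :
  (forall i, measurable_fun setT (X i)) ->
  measurable_fun setT (fun w => vmax (X^~ w)).
Proof.
move=> mX; rewrite /vmax.
elim: (index_enum _) => [|i r IH].
  by under eq_fun do rewrite big_nil; exact: mX.
under eq_fun do rewrite big_cons.
exact: measurable_maxr.
Qed.

Lemma itg_vmax p (X : 'I_p.+1 -> Omega -> R) :
  (forall i, itg (X i)) -> itg (fun w => vmax (X^~ w)).
Proof.
move=> iX; apply: (@itg_le _ (fun w => \sum_(i < p.+1) `|X i w|)).
- by apply: mf_vmax => i; exact: itg_mf.
- by apply: itg_sum => i _; exact: itg_abs.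
- by move=> w; exact: vmax_le_sum_norm.
Qed.

Lemma mean_le X Y : itg X -> itg Y -> (forall w, X w <= Y w) -> mean X <= mean Y.
Proof. by move=> iX iY XY; apply: le_Rintegral. Qed.

Lemma meanD X Y : itg X -> itg Y -> mean (fun w => X w + Y w) = mean X + mean Y.
Proof. by move=> iX iY; rewrite /mean RintegralD. Qed.

Lemma meanB X Y : itg X -> itg Y -> mean (fun w => X w - Y w) = mean X - mean Y.
Proof. by move=> iX iY; rewrite /mean RintegralB. Qed.

Lemma meanZ (c : R) X : itg X -> mean (fun w => c * X w) = c * mean X.
Proof. by move=> iX; rewrite /mean RintegralZl. Qed.

Lemma mean_cst (c : R) : mean (fun=> c) = c.
Proof.
rewrite /mean Rintegral_cst// [fine _](_ : _ = 1) ?mulr1//.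
exact: (congr1 fine (probability_setT P)).
Qed.

Lemma mean_sum (I : Type) (r : seq I) (S : pred I) (X : I -> Omega -> R) :
  (forall i, S i -> itg (X i)) ->
  mean (fun w => \sum_(i <- r | S i) X i w) = \sum_(i <- r | S i) mean (X i).
Proof.
move=> iX; elim: r => [|i r IH].
  by under eq_fun do rewrite big_nil; rewrite mean_cst big_nil.
under eq_fun do rewrite big_cons; rewrite big_cons; case Si: (S i) => //.
by rewrite meanD ?IH//; [exact: iX|exact: itg_sum].
Qed.

Lemma eq_mean_vmax p (X Y : 'I_p.+1 -> Omega -> R) :
  (forall w i, X i w = Y i w) ->
  mean (fun w => vmax (X^~ w)) = mean (fun w => vmax (Y^~ w)).
Proof.
by move=> XY; congr mean; apply/funext => w; apply: eq_vmax => i; exact: XY.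
Qed.

Lemma vmax_mean p (X : 'I_p.+1 -> Omega -> R) : (forall i, itg (X i)) ->
  vmax (fun i => mean (X i)) <= mean (fun w => vmax (X^~ w)).
Proof.
move=> iX; apply: vmax_le => i; apply: mean_le => //; first exact: itg_vmax.
by move=> w; exact: (le_vmax (X^~ w)).
Qed.

(* For non-measurable functions the integral is a difference of lower
   integrals, which is still monotone. *)
Lemma le_integral_pointwise (f g : Omega -> \bar R) :
  (forall w, f w <= g w)%E -> (\int[P]_w f w <= \int[P]_w g w)%E.
Proof.
move=> fg; rewrite /integral !patch_setT; apply: leeB.
- apply: le_ereal_sup => _ [h hf <-]; exists h => // w.
  apply: le_trans (hf w) _; rewrite !funeposE.
  by rewrite ge_max !le_max fg lexx orbT.
- apply: le_ereal_sup => _ [h hf <-]; exists h => // w.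
  apply: le_trans (hf w) _; rewrite !funenegE.
  by rewrite ge_max !le_max leeN2 fg lexx orbT.
Qed.

End mean.

(** * Replacement of independent blocks *)

Section replacement.
Context d (Omega : measurableType d) (R : realType) (P : probability Omega R).
Variables (I : finType) (F : I -> set (set Omega)).
Hypothesis Fm : forall s, F s `<=` measurable.
Hypothesis FT : forall s, F s setT.
Hypothesis FI : forall s, setI_closed (F s).
Hypothesis Findep : independent_systems P F.

(** Encodes that X is a function of the sources in J only: measurability for the sigma-algebra that
    these sources generate. *)
Definition sub_measurable d' (T : measurableType d') (J : {set I})
  (X : Omega -> T) :=
  measurable_fun setT (X : g_sigma_algebraType (sigma_join F J) -> T).

Lemma sub_measurableT d' (T : measurableType d') (J : {set I}) (X : Omega -> T) :
  sub_measurable J X -> measurable_fun setT X.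
Proof.
move=> mX _ B mB; apply: (sigma_join_measurable Fm (J := J)).
exact: (mX measurableT B mB).
Qed.

Lemma sub_measurableS d' (T : measurableType d') (J K : {set I}) (X : Omega -> T) :
  J \subset K -> sub_measurable J X -> sub_measurable K X.
Proof.
move=> JK mX _ B mB; apply: (sub_sigma_join JK).
exact: (mX measurableT B mB).
Qed.

Lemma sub_measurable_events d' (T : measurableType d') (J : {set I}) s
  (X : Omega -> T) : s \in J -> events_of X `<=` F s -> sub_measurable J X.
Proof.
move=> sJ XF _ B mB; apply: sub_sigma_algebra; exists s => //.
by apply: XF; exists B.
Qed.

Lemma sub_measurable_indep d1 d2 (T1 : measurableType d1) (T2 : measurableType d2)
  (J K : {set I}) (X : Omega -> T1) (Y : Omega -> T2) :
  (forall s, s \in J -> s \notin K) -> sub_measurable J X -> sub_measurable K Y ->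
  indep2 P X Y.
Proof.
move=> dJK mX mY A B mA mB.
apply: (sigma_join_indep Fm FT FI Findep dJK).
  by rewrite -[X in <<s _ >> X]setTI; exact: (mX measurableT).
by rewrite -[X in <<s _ >> X]setTI; exact: (mY measurableT).
Qed.

(** A finite family seen as one random vector, so that [indep2] can express joint independence of
    the whole family. *)
Definition tup p (X : 'I_p -> Omega -> R) (w : Omega) : p.-tuple R :=
  [tuple X i w | i < p].

Lemma sub_measurable_tup p (J : {set I}) (X : 'I_p -> Omega -> R) :
  (forall i, sub_measurable J (X i)) -> sub_measurable J (tup X).
Proof.
move=> mX; apply/measurable_fun_tnthP => i.
have -> : @tnth _ _ ^~ i \o tup X = X i.
  by apply/funext => w /=; rewrite tnth_mktuple.
exact: mX.
Qed.

Variable p : nat.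
Implicit Types A D : 'I_p.+1 -> Omega -> R.

Let psi (z : p.+1.-tuple R * p.+1.-tuple R) : R :=
  vmax (fun l => tnth z.1 l + tnth z.2 l).

Let mpsi : measurable_fun setT psi.
Proof.
apply: (@mf_vmax R _ (p.+1.-tuple R * p.+1.-tuple R)%type p
  (fun l z => tnth z.1 l + tnth z.2 l)) => l.
apply: measurable_funD.
  by apply: (@measurableT_comp _ _ _ _ _ _ (@tnth _ _ ^~ l)) => //; exact: measurable_tnth.
by apply: (@measurableT_comp _ _ _ _ _ _ (@tnth _ _ ^~ l)) => //; exact: measurable_tnth.
Qed.

Let psi_integral (J K : {set I}) A D :
  (forall s, s \in J -> s \notin K) ->
  (forall l, sub_measurable J (A l)) -> (forall l, sub_measurable K (D l)) ->
  (forall l, itg P (A l)) -> (forall l, itg P (D l)) ->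
  (\int[P]_w (vmax (fun l => A l w + D l w))%:E =
   \int[P]_w (mean P (fun w' => vmax (fun l => A l w + D l w')))%:E)%E.
Proof.
move=> dJK mA mD iA iD.
have smA := sub_measurable_tup mA; have smD := sub_measurable_tup mD.
pose X : {RV P >-> p.+1.-tuple R} := mfun_Sub (mem_set (sub_measurableT smA)).
pose Y : {RV P >-> p.+1.-tuple R} := mfun_Sub (mem_set (sub_measurableT smD)).
have XY : indep2 P X Y by exact: (sub_measurable_indep dJK smA smD).
have psiE w w' : psi (X w, Y w') = vmax (fun l => A l w + D l w').
  by apply: eq_vmax => l /=; rewrite !tnth_mktuple.
have iAD w : itg P (fun w' => vmax (fun l => A l w + D l w')).
  by apply: itg_vmax => l; apply: itgD => //; exact: itg_cst.
transitivity (\int[P]_w (psi (X w, Y w))%:E)%E.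
  by apply: eq_integral => w _; rewrite psiE.
rewrite (indep_integral XY mpsi).
- apply: eq_integral => w _; rewrite meanE//.
  by apply: eq_integral => w' _; rewrite psiE.
- rewrite (_ : (fun w => _) = (fun w => (vmax (fun l => A l w + D l w))%:E)).
    by apply: itg_vmax => l; apply: itgD.
  by apply/funext => w; rewrite psiE.
- move=> x; apply: (@itg_vmax _ _ _ P p (fun l w' => tnth x l + tnth (Y w') l)) => l.
  apply: itgD; first exact: itg_cst.
  by rewrite (_ : (fun w => _) = D l)//; apply/funext => w /=; rewrite tnth_mktuple.
Qed.

(** By independence A may be frozen at its value, which becomes the constant vector [a] of the last
    hypothesis; the resulting inequality is then integrated over A. *)
Lemma replace_block (J K : {set I}) A D D' :
  (forall s, s \in J -> s \notin K) ->
  (forall l, sub_measurable J (A l)) ->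
  (forall l, sub_measurable K (D l)) -> (forall l, sub_measurable K (D' l)) ->
  (forall l, itg P (A l)) -> (forall l, itg P (D l)) -> (forall l, itg P (D' l)) ->
  (forall a : 'I_p.+1 -> R, mean P (fun w => vmax (fun l => a l + D l w)) <=
     mean P (fun w => vmax (fun l => a l + D' l w))) ->
  mean P (fun w => vmax (fun l => A l w + D l w)) <=
  mean P (fun w => vmax (fun l => A l w + D' l w)).
Proof.
move=> dJK mA mD mD' iA iD iD' DD'.
rewrite -lee_fin !meanE; first last.
- by apply: itg_vmax => l; exact: itgD.
- by apply: itg_vmax => l; exact: itgD.
rewrite (psi_integral dJK mA mD iA iD) (psi_integral dJK mA mD' iA iD').
by apply: le_integral_pointwise => w; rewrite lee_fin.
Qed.

Lemma sub_measurableD (J : {set I}) (X Y : Omega -> R) :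
  sub_measurable J X -> sub_measurable J Y ->
  sub_measurable J (fun w => X w + Y w).
Proof. exact: measurable_funD. Qed.

Lemma sub_measurable_sum (T : eqType) (r : seq T) (J : {set I})
  (X : T -> Omega -> R) : {in r, forall t, sub_measurable J (X t)} ->
  sub_measurable J (fun w => \sum_(t <- r) X t w).
Proof.
elim: r => [|t r IH] mX.
  by rewrite /sub_measurable; under eq_fun do rewrite big_nil; exact: measurable_cst.
rewrite /sub_measurable; under eq_fun do rewrite big_cons.
apply: sub_measurableD; first by apply: mX; rewrite inE eqxx.
by apply: IH => u ur; apply: mX; rewrite inE ur orbT.
Qed.

(** Lindeberg's exchange of one block at a time, here without error terms because every exchange is
    an inequality valid for all frozen values. *)
Lemma replace_blocks (T : eqType) (r : seq T) (J : T -> {set I})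
  (D D' : T -> 'I_p.+1 -> Omega -> R) :
  uniq r ->
  {in r &, forall t u, t != u -> forall s, s \in J t -> s \notin J u} ->
  (forall t l, sub_measurable (J t) (D t l)) ->
  (forall t l, sub_measurable (J t) (D' t l)) ->
  (forall t l, itg P (D t l)) -> (forall t l, itg P (D' t l)) ->
  (forall t (a : 'I_p.+1 -> R), t \in r ->
     mean P (fun w => vmax (fun l => a l + D t l w)) <=
     mean P (fun w => vmax (fun l => a l + D' t l w))) ->
  mean P (fun w => vmax (fun l => \sum_(t <- r) D t l w)) <=
  mean P (fun w => vmax (fun l => \sum_(t <- r) D' t l w)).
Proof.
move=> ur dJ mD mD' iD iD' DD'.
(* The induction carries a spectator [B], which depends only on sources foreign to the remaining
   blocks. *)
suff H (B : 'I_p.+1 -> Omega -> R) K : (forall l, itg P (B l)) ->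
    (forall l, sub_measurable K (B l)) ->
    {in r, forall t s, s \in J t -> s \notin K} ->
    mean P (fun w => vmax (fun l => B l w + \sum_(t <- r) D t l w)) <=
    mean P (fun w => vmax (fun l => B l w + \sum_(t <- r) D' t l w)).
  have E (G : T -> 'I_p.+1 -> Omega -> R) :
      mean P (fun w => vmax (fun l => \sum_(t <- r) G t l w)) =
      mean P (fun w => vmax (fun l => 0 + \sum_(t <- r) G t l w)).
    by apply: eq_mean_vmax => w l; rewrite add0r.
  rewrite (E D) (E D'); apply: (H (fun _ _ => 0) finset.set0).
  - by move=> l; exact: itg_cst.
  - by move=> l; exact: measurable_cst.
  - by move=> t _ s _; rewrite finset.in_set0.
elim: r ur dJ DD' B K => [_ _ _|t r IH /= /andP[tr ur] dJ DD'] B K iB mB dK.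
  by rewrite le_eqVlt (eq_mean_vmax P (X := fun l w => _ + _)
    (Y := fun l w => B l w + \sum_(t <- [::]) D' t l w)) ?eqxx// => w l; rewrite !big_nil.
have iS (E : T -> 'I_p.+1 -> Omega -> R) l : (forall t l, itg P (E t l)) ->
    itg P (fun w => \sum_(t <- r) E t l w).
  by move=> iE; apply: itg_sum.
(* The tail is exchanged while the head [D t] counts as spectator; then the head is exchanged
   against [B] plus the new tail. *)
apply: (@le_trans _ _ (mean P (fun w => vmax (fun l =>
    (B l w + D t l w) + \sum_(u <- r) D' u l w)))).
  rewrite (eq_mean_vmax _ (Y := fun l w => (B l w + D t l w) + \sum_(u <- r) D u l w)).
    2: by move=> w l; rewrite big_cons addrA.
  apply: (IH ur _ _ (fun l w => B l w + D t l w) (K :|: J t)%SET).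
  - by move=> u v ur' vr'; apply: dJ; rewrite inE ?ur' ?vr' orbT.
  - by move=> u a ur'; apply: DD'; rewrite inE ur' orbT.
  - by move=> l; exact: itgD.
  - move=> l; apply: sub_measurableD.
      exact: sub_measurableS (finset.subsetUl _ _) (mB l).
    exact: sub_measurableS (finset.subsetUr _ _) (mD t l).
  - move=> u ur' s sJ; rewrite finset.in_setU negb_or.
    rewrite (dK u _ s)//= ?inE ?ur' ?orbT//.
    apply: (dJ u t) => //; rewrite ?inE ?ur' ?eqxx ?orbT//.
    by apply: contraNneq tr => <-.
pose JS := [set s | (s \in K) || has (fun u => s \in J u) r]%SET.
have mS l : sub_measurable JS (fun w => B l w + \sum_(u <- r) D' u l w).
  apply: sub_measurableD.
    apply: sub_measurableS (mB l).
    by apply/fintype.subsetP => s sK; rewrite finset.inE sK.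
  apply: sub_measurable_sum => u uin; apply: sub_measurableS (mD' u l).
  apply/fintype.subsetP => s sJ; rewrite finset.inE; apply/orP; right.
  by apply/hasP; exists u.
rewrite (eq_mean_vmax _ (Y := fun l w => (B l w + \sum_(u <- r) D' u l w) + D t l w)).
  2: by move=> w l; rewrite addrAC.
rewrite [leRHS](eq_mean_vmax _ (Y := fun l w =>
  (B l w + \sum_(u <- r) D' u l w) + D' t l w)).
  2: by move=> w l; rewrite big_cons (addrC (D' t l w)) addrA.
apply: (@replace_block JS (J t) (fun l w => B l w + \sum_(u <- r) D' u l w)) => //.
- move=> s; rewrite finset.inE => /orP[sK|/hasP[u uin sJ]].
    by apply: contraL sK => /dK; apply; rewrite inE eqxx.
  apply: (dJ u t) => //; rewrite ?inE ?uin ?eqxx ?orbT//.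
  by apply: contraNneq tr => <-.
- by move=> l; apply: itgD => //; exact: iS.
- by move=> a; apply: DD'; rewrite inE eqxx.
Qed.

End replacement.

(** * The standard normal law *)

Section normal.
Context (R : realType).
Notation nu := (@normal_prob R 0 1).
Notation mu := (@lebesgue_measure R).
Notation phi := (@normal_pdf R 0 1).

Lemma normal_probN (A : set R) : measurable A -> nu (-%R @^-1` A) = nu A.
Proof.
move=> mA; rewrite /normal_prob.
transitivity (\int[pushforward mu (-%R : _ -> measurableTypeR R)]_(x in A) (phi x)%:E)%E;
    last first.
  by apply: eq_measure_integral => B mB _; exact: lebesgue_measureN.
rewrite ge0_integral_pushforward//.
- apply: eq_integral => x _ /=; congr EFin.
  rewrite !normal_pdfE ?oner_eq0//= /normal_fun !subr0 sqrrN//.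
- by apply/measurable_EFinP; apply: measurable_funTS; exact: measurable_normal_pdf.
- by move=> x _; rewrite lee_fin normal_pdf_ge0.
Qed.

(** An integrable majorant for the first moment: the density of standard deviation 2 exceeds the
    standard one by a factor exp(3 x^2 / 8), up to normalization, and 3 (1 + 3 y^2 / 8) >= y + 1. *)
Lemma normal_pdf_abs_le (x : R) :
  (`|x| + 1) * phi x <= 3 * normal_peak 1 / normal_peak 2 * normal_pdf 0 2 x.
Proof.
have p2 : 0 < normal_peak (2 : R) by rewrite normal_peak_gt0.
rewrite !normal_pdfE ?oner_eq0 ?pnatr_eq0//= /normal_fun !subr0.
set e1 := expR _; set e2 := expR (- _ / (2 ^+ 2 *+ 2)).
rewrite (_ : _ * (_ * e1) = normal_peak 1 * ((`|x| + 1) * e1)); last by ring.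
rewrite (_ : _ * (_ * e2) = normal_peak 1 * (3 * e2)); last first.
  by field; rewrite gt_eqF.
rewrite ler_wpM2l ?normal_peak_ge0//.
have -> : e2 = expR (3 / 8 * x ^+ 2) * e1 by rewrite -expRD; congr expR; field.
rewrite mulrA ler_wpM2r ?expR_ge0//.
have := expR_ge1Dx (3 / 8 * x ^+ 2); rewrite -(real_normK (num_real x)).
set y := `|x|; move: (expR _) => e ye; nra.
Qed.

(** On the shell n <= |x| < n + 1 the integrand is below the constant n + 1, and the mass of a shell
    is by definition a Lebesgue integral of the density. Since n + 1 <= |x| + 1 there, summing the
    shells gives a Lebesgue integral covered by [normal_pdf_abs_le]. *)
Lemma integral_abs_normal_lty : (\int[nu]_x `|x%:E| < +oo)%E.
Proof.
pose A (n : nat) := [set x : R | n%:R <= `|x| < n.+1%:R].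
have mabs : measurable_fun setT (fun x : R => `|x|) by exact: normr_measurable.
have mA n : measurable (A n).
  have -> : A n = (fun x : R => `|x|) @^-1` `[n%:R, n.+1%:R[.
    by apply/seteqP; split => x /=; rewrite in_itv.
  by rewrite -[X in measurable X]setTI; exact: mabs.
have tA : trivIset setT A.
  move=> i j _ _ [x [/= /andP[ix xi] /andP[jx xj]]].
  have := le_lt_trans ix xj; have := le_lt_trans jx xi.
  rewrite !ltr_nat !ltnS => ji ij; apply/eqP; rewrite eqn_leq ij//.
have AT : \bigcup_n A n = setT.
  apply/seteqP; split => // x _; exists (Num.truncn `|x|) => //=.
  exact: truncn_itv.
have mAR n : @measurable _ (measurableTypeR R) (A n) by exact: mA.
have mabsE D : measurable_fun D (fun x : measurableTypeR R => `|x%:E|%E).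
  by apply/measurable_EFinP; exact: measurable_funTS.
have mf D : measurable_fun D (fun x : measurableTypeR R => ((`|x| + 1) * phi x)%:E).
  apply/measurable_EFinP; apply: measurable_funTS; apply: measurable_funM.
    exact: measurable_funD.
  exact: measurable_normal_pdf.
have f0 x : (0 <= ((`|x| + 1) * phi x)%:E)%E.
  by rewrite lee_fin mulr_ge0 ?addr_ge0// normal_pdf_ge0.
rewrite -AT ge0_integral_bigcup//.
have le1 n : (\int[nu]_(x in A n) `|x%:E| <=
              \int[mu]_(x in A n) ((`|x| + 1) * phi x)%:E)%E.
  apply: (@le_trans _ _ (\int[nu]_(x in A n) (n.+1%:R)%:E)%E).
    by apply: ge0_le_integral => // x /andP[_ /ltW]; rewrite lee_fin.
  rewrite integral_cst//.
  apply: (@le_trans _ _ ((n.+1%:R)%:E * \int[mu]_(x in A n) (phi x)%:E)%E) => //.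
  rewrite -ge0_integralZl//; last 2 first.
  - by apply/measurable_EFinP; apply: measurable_funTS; exact: measurable_normal_pdf.
  - by move=> x _; rewrite lee_fin normal_pdf_ge0.
  apply: ge0_le_integral => //.
  - by move=> x _; rewrite mule_ge0// lee_fin normal_pdf_ge0.
  - apply: emeasurable_funM => //.
    by apply/measurable_EFinP; apply: measurable_funTS; exact: measurable_normal_pdf.
  - move=> x /andP[nx _]; rewrite -EFinM lee_fin ler_wpM2r ?normal_pdf_ge0//.
    by rewrite -natr1 lerD2r.
apply: (@le_lt_trans _ _ (\sum_(i <oo) \int[mu]_(x in A i) ((`|x| + 1) * phi x)%:E)%E).
  by apply: lee_nneseries => [n _ _|n _]; [exact: integral_ge0|exact: le1].
rewrite -ge0_integral_bigcup// AT.
apply: (@le_lt_trans _ _ (\int[mu]_x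
    ((3 * normal_peak 1 / normal_peak 2)%:E * (normal_pdf 0 2 x)%:E))%E).
  apply: ge0_le_integral => //.
  - apply: emeasurable_funM => //.
    by apply/measurable_EFinP; exact: measurable_normal_pdf.
  - by move=> x _; rewrite -EFinM lee_fin; exact: normal_pdf_abs_le.
rewrite integralZl//; last exact: integrable_normal_pdf.
by rewrite integral_normal_pdf mule1 ltry.
Qed.

Definition normal_abs_mean : R := fine (\int[nu]_x `|x%:E|)%E.

(** A zero mean would force x = 0 almost surely, but the law has a density and gives no mass to a
    point. *)
Lemma normal_abs_mean_gt0 : 0 < normal_abs_mean.
Proof.
have mabsE : measurable_fun setT (fun x : measurableTypeR R => x%:E).
  exact/measurable_EFinP.
rewrite fine_gt0// integral_abs_normal_lty andbT lt_neqAle.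
rewrite integral_ge0 ?andbT//; apply/eqP => /esym /ae_eq_integral_abs.
move=> /(_ measurableT mabsE)[N [mN N0 subN]].
have nu0 : nu [set 0%R] = 0%E by rewrite /normal_prob integral_set1.
have : (nu setT <= nu (N `|` [set 0%R]))%E.
  apply: le_measure; rewrite ?inE//; first exact: measurableU.
  move=> x _; have [->|x0] := eqVneq x 0; [by right|left].
  by apply: subN => /= /(_ I) [] /eqP; rewrite (negbTE x0).
rewrite probability_setT leNgt => /negP; apply.
apply: (@le_lt_trans _ _ (nu N + nu [set 0%R])%E); first exact: measureU2.
by rewrite N0 nu0 adde0 lte01.
Qed.

End normal.

Section independent_pairs.
Context d (Omega : measurableType d) (R : realType) (P : probability Omega R).

Lemma indep_mean_mono d1 d2 (T1 : measurableType d1) (T2 : measurableType d2)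
  (X : Omega -> T1) (Y : Omega -> T2) (psi psi' : T1 * T2 -> R) :
  measurable_fun setT X -> measurable_fun setT Y -> indep2 P X Y ->
  measurable_fun setT psi -> measurable_fun setT psi' ->
  itg P (fun w => psi (X w, Y w)) -> itg P (fun w => psi' (X w, Y w)) ->
  (forall x, itg P (fun w => psi (x, Y w))) ->
  (forall x, itg P (fun w => psi' (x, Y w))) ->
  (forall x, mean P (fun w => psi (x, Y w)) <= mean P (fun w => psi' (x, Y w))) ->
  mean P (fun w => psi (X w, Y w)) <= mean P (fun w => psi' (X w, Y w)).
Proof.
move=> mX mY XY mpsi mpsi' ipsi ipsi' i1 i1' le.
pose X' : {RV P >-> T1} := mfun_Sub (mem_set mX).
pose Y' : {RV P >-> T2} := mfun_Sub (mem_set mY).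
have iterate (phi : T1 * T2 -> R) : measurable_fun setT phi ->
    itg P (fun w => phi (X w, Y w)) -> (forall x, itg P (fun w => phi (x, Y w))) ->
    (\int[P]_w (phi (X w, Y w))%:E =
     \int[P]_w \int[P]_w' (phi (X' w, Y' w'))%:E)%E.
  by move=> *; apply: (@indep_integral _ _ _ _ _ _ _ P X' Y').
rewrite -lee_fin !meanE// !iterate//.
by apply: le_integral_pointwise => w; rewrite -!meanE// lee_fin.
Qed.

Lemma indep2_comp d1 d2 d3 (T1 : measurableType d1) (T2 : measurableType d2)
  (T3 : measurableType d3) (X : Omega -> T1) (Y : Omega -> T2) (f : T1 -> T3) :
  measurable_fun setT f -> indep2 P X Y -> indep2 P (f \o X) Y.
Proof.
move=> mf XY A B mA mB; rewrite comp_preimage; apply: XY => //.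
by rewrite -[X in measurable X]setTI; exact: mf.
Qed.

Variables (X Y : Omega -> R).
Hypotheses (iX : itg P X) (iY : itg P Y) (XY : indep2 P X Y).

Let X' : {RV P >-> R} := mfun_Sub (mem_set (itg_mf iX)).
Let Y' : {RV P >-> R} := mfun_Sub (mem_set (itg_mf iY)).

Let mmul : measurable_fun setT (fun z : R * R => z.1 * z.2).
Proof. exact: measurable_funM. Qed.

Lemma indep_itgM : itg P (fun w => X w * Y w).
Proof.
apply/integrableP; split.
  by apply/measurable_EFinP; apply: measurable_funM;
    [exact: (itg_mf iX)|exact: (itg_mf iY)].
have -> : (\int[P]_w `|(X w * Y w)%:E| = \int[P]_w \int[P]_w' `|(X' w * Y' w')%:E|)%E.
  apply: (@indep_ge0_integral _ _ _ _ _ _ _ P X' Y' XY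
    (fun z => `|(z.1 * z.2)%:E|%E)) => //.
  by apply: measurableT_comp => //; exact/measurable_EFinP.
rewrite (eq_integral (fun w => (mean P (fun w' => `|Y w'|) * `|X w|)%:E)).
  by rewrite -meanE ?ltry//; apply: itgZ; exact: itg_abs.
move=> w _; rewrite mulrC -meanZ; last exact: itg_abs.
rewrite meanE; last by apply: itgZ; exact: itg_abs.
by apply: eq_integral => w' _; rewrite abse_EFin normrM.
Qed.

Lemma indep_meanM : mean P (fun w => X w * Y w) = mean P X * mean P Y.
Proof.
apply: EFin_inj; rewrite meanE; last exact: indep_itgM.
have -> : (\int[P]_w (X w * Y w)%:E = \int[P]_w \int[P]_w' (X' w * Y' w')%:E)%E.
  apply: (@indep_integral _ _ _ _ _ _ _ P X' Y' XY (fun z => z.1 * z.2)) => //.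
    exact: indep_itgM.
  by move=> x; exact: itgZ.
rewrite (eq_integral (fun w => (mean P Y * X w)%:E)) => [|w _].
  by rewrite -meanE ?meanZ 1?mulrC//; exact: itgZ.
by rewrite mulrC -meanZ// meanE//; exact: itgZ.
Qed.

End independent_pairs.

(** * Moments and symmetry of a standard normal variable *)

Section gaussian_noise.
Context d (Omega : measurableType d) (R : realType) (P : probability Omega R).
Notation kappa := (normal_abs_mean R).
Variable Z : Omega -> R.
Hypothesis mZ : measurable_fun setT Z.
Hypothesis ZN : forall B : set R, measurable B -> P (Z @^-1` B) = normal_prob 0 1 B.

Let Z' : {RV P >-> measurableTypeR R} :=
    @mfun_Sub _ _ Omega (measurableTypeR R) Z (mem_set mZ).

Let lawZ : forall A, measurable A -> A `<=` setT ->
  distribution P Z' A = @normal_prob R 0 1 A.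
Proof. by move=> A mA _; exact: ZN. Qed.

Let integral_absZ : (\int[P]_w `|(Z w)%:E| = \int[@normal_prob R 0 1]_x `|x%:E|)%E.
Proof.
transitivity (\int[distribution P Z']_x `|x%:E|)%E.
  rewrite ge0_integral_distribution//.
  by apply: measurableT_comp => //; exact/measurable_EFinP.
by apply: (@eq_measure_integral _ _ _ _ (normal_prob 0 1)) => A mA AT; exact: lawZ.
Qed.

Lemma itg_normal : itg P Z.
Proof.
apply/integrableP; split; first exact/measurable_EFinP.
by rewrite integral_absZ integral_abs_normal_lty.
Qed.

Lemma mean_abs_normal : mean P (fun w => `|Z w|) = kappa.
Proof. by rewrite /normal_abs_mean -integral_absZ. Qed.

Lemma mean_normalN (f : R -> R) : measurable_fun setT f -> itg P (f \o Z) ->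
  mean P (fun w => f (- Z w)) = mean P (fun w => f (Z w)).
Proof.
move=> mf ifZ.
have mN : measurable_fun setT (fun w => - Z w) by exact: measurableT_comp.
pose N : {RV P >-> measurableTypeR R} :=
    @mfun_Sub _ _ Omega (measurableTypeR R) _ (mem_set mN).
have lawN A : measurable A -> A `<=` setT -> distribution P N A = distribution P Z' A.
  move=> mA _; rewrite [RHS]lawZ// -normal_probN//.
  by rewrite -ZN// -[X in measurable X]setTI; exact: oppr_measurable.
congr fine.
have iZ' : (distribution P Z').-integrable setT (EFin \o f).
  by apply: integrable_pushforward => //; exact/measurable_EFinP.
have iN' : (distribution P N).-integrable setT (EFin \o f).
  apply/integrableP; split; first exact/measurable_EFinP.
  by rewrite (eq_measure_integral _ lawN); have /integrableP[] := iZ'.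
transitivity (\int[distribution P N]_x (f x)%:E)%E.
  rewrite integral_distribution//; first exact/measurable_EFinP.
  apply/integrableP; split.
    by apply/measurable_EFinP; exact: measurableT_comp.
  have /integrableP[_] := iN'.
  rewrite ge0_integral_distribution//.
  by apply: measurableT_comp => //; exact/measurable_EFinP.
rewrite (eq_measure_integral _ lawN) integral_distribution//.
exact/measurable_EFinP.
Qed.

Lemma mean_normal0 : mean P Z = 0.
Proof.
have := @mean_normalN id (@measurable_id _ _ _) itg_normal.
rewrite -[X in X = _]/(mean P (fun w => - Z w)).
under eq_fun do rewrite -mulN1r; rewrite meanZ; last exact: itg_normal.
by rewrite mulN1r /=; lra.
Qed.

End gaussian_noise.

(** * Gaussian contraction for one pair of vertices *)

Section vmax2.
Context (R : realType) (p : nat).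
Implicit Types (a u : 'I_p.+1 -> R) (q : 'I_p.+1 -> 'I_p.+1 -> R).

Definition vmax2 q : R := vmax (fun l => vmax (q l)).

Lemma le_vmax2 q l l' : q l l' <= vmax2 q.
Proof.
by apply: le_trans (le_vmax (q l) l') _; exact: (le_vmax (fun l => vmax (q l))).
Qed.

Lemma vmax2_le q c : (forall l l', q l l' <= c) -> vmax2 q <= c.
Proof. by move=> qc; do 2 apply: vmax_le => ?. Qed.

Lemma vmax2_sym a u :
  vmax2 (fun l l' => a l + a l' + `|u l - u l'|) =
  vmax (fun l => a l + u l) + vmax (fun l => a l - u l).
Proof.
apply/eqP; rewrite eq_le; apply/andP; split.
  apply: vmax2_le => l l'.
  have hp j := le_vmax (fun l => a l + u l) j.
  have hm j := le_vmax (fun l => a l - u l) j.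
  have := hp l; have := hp l'; have := hm l; have := hm l'.
  by case: (lerP (u l') (u l)) => /= *; lra.
have [l ->] := vmaxP (fun l => a l + u l); have [l' ->] := vmaxP (fun l => a l - u l).
apply: le_trans (le_vmax2 _ l l').
by have := ler_norm (u l - u l') => /=; lra.
Qed.

(** Convexity of the maximum, as a + u is the midpoint of a and a + 2 u. It isolates the term
    [vmax a] that the symmetrization provides on the other side. *)
Lemma vmax_double a u :
  2 * vmax (fun l => a l + u l) <= vmax a + vmax (fun l => a l + 2 * u l).
Proof.
have [l ->] := vmaxP (fun l => a l + u l).
have := le_vmax a l; have := le_vmax (fun l => a l + 2 * u l) l => /=; lra.
Qed.

Lemma vmax2_midpoint (b q r : 'I_p.+1 -> 'I_p.+1 -> R) :
  2 * vmax2 (fun l l' => b l l' + (q l l' + r l l')) <=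
  vmax2 (fun l l' => b l l' + 2 * q l l') + vmax2 (fun l l' => b l l' + 2 * r l l').
Proof.
rewrite mulrC -ler_pdivlMr//; apply: vmax2_le => l l'.
have := le_vmax2 (fun l l' => b l l' + 2 * q l l') l l'.
have := le_vmax2 (fun l l' => b l l' + 2 * r l l') l l' => /=; lra.
Qed.

Lemma vmax2S q r : (forall l l', q l l' <= r l l') -> vmax2 q <= vmax2 r.
Proof. by move=> qr; do 2 apply: vmaxS => ?. Qed.

End vmax2.

Section gaussian_contraction.
Context d (Omega : measurableType d) (R : realType) (P : probability Omega R).
Notation kappa := (normal_abs_mean R).
Variable p : nat.
Implicit Types (a : 'I_p.+1 -> R) (S : 'I_p.+1 -> Omega -> R).

Lemma itg_vmax2 (q : 'I_p.+1 -> 'I_p.+1 -> Omega -> R) :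
  (forall l l', itg P (q l l')) -> itg P (fun w => vmax2 (fun l l' => q l l' w)).
Proof.
by move=> iq; apply: (@itg_vmax _ _ _ P p (fun l w => vmax ((q l)^~ w))) => l;
  exact: itg_vmax.
Qed.

Variables (S : 'I_p.+1 -> Omega -> R) (Z : Omega -> R).
Hypothesis iS : forall l, itg P (S l).
Hypothesis mZ : measurable_fun setT Z.
Hypothesis ZN : forall B : set R, measurable B -> P (Z @^-1` B) = normal_prob 0 1 B.
Hypothesis SZ : indep2 P (tup S) Z.

Let iZ : itg P Z. Proof. exact: itg_normal. Qed.

Let mS : measurable_fun setT (tup S).
Proof.
apply/measurable_fun_tnthP => l.
have -> : @tnth _ _ ^~ l \o tup S = S l.
  by apply/funext => w /=; rewrite tnth_mktuple.
exact: itg_mf.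
Qed.

Let mtnth l : measurable_fun setT (fun z : p.+1.-tuple R * R => tnth z.1 l).
Proof.
apply: (@measurableT_comp _ _ _ _ _ _ (@tnth _ _ ^~ l)) => //.
exact: measurable_tnth.
Qed.

Lemma indep2_coord l : indep2 P (S l) Z.
Proof.
have -> : S l = @tnth _ _ ^~ l \o tup S.
  by apply/funext => w /=; rewrite tnth_mktuple.
by apply: indep2_comp SZ; exact: measurable_tnth.
Qed.

Lemma itg_noise l : itg P (fun w => Z w * S l w).
Proof.
have := indep_itgM (iS l) iZ (indep2_coord l).
by congr itg; apply/funext => w; rewrite mulrC.
Qed.

Lemma mean_noise l : mean P (fun w => Z w * S l w) = 0.
Proof.
have := indep_meanM (iS l) iZ (indep2_coord l).
rewrite (mean_normal0 mZ ZN) mulr0 => <-.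
by congr mean; apply/funext => w; rewrite mulrC.
Qed.

Variables (a : 'I_p.+1 -> R) (tau : R).
Hypothesis tau0 : 0 <= tau.

Let c := tau / kappa.

Let psi (e : R) (z : p.+1.-tuple R * R) := vmax (fun l => a l + e * (z.2 * tnth z.1 l)).

Let mpsi e : measurable_fun setT (psi e).
Proof.
apply: (@mf_vmax R _ (p.+1.-tuple R * R)%type p
  (fun l z => a l + e * (z.2 * tnth z.1 l))) => l.
by apply: measurable_funD => //; do 2 apply: measurable_funM => //.
Qed.

Let ipsi e : itg P (fun w => psi e (tup S w, Z w)).
Proof.
rewrite (_ : (fun w => _) = (fun w => vmax (fun l => a l + e * (Z w * S l w)))).
  apply: itg_vmax => l; apply: itgD; first exact: itg_cst.
  by apply: itgZ; exact: itg_noise.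
by apply/funext => w; apply: eq_vmax => l; rewrite tnth_mktuple.
Qed.

Let ipsi1 e x : itg P (fun w => psi e (x, Z w)).
Proof.
apply: (@itg_vmax _ _ _ P p (fun l w => a l + e * (Z w * tnth x l))) => l.
apply: itgD; first exact: itg_cst.
rewrite (_ : (fun w => _) = (fun w => (e * tnth x l) * Z w)); first exact: itgZ.
by apply/funext => w; ring.
Qed.

(** Given S, the sign of the scale is absorbed by the symmetry of the law of Z. *)
Let psiN : mean P (fun w => psi (- c) (tup S w, Z w)) <=
           mean P (fun w => psi c (tup S w, Z w)).
Proof.
apply: indep_mean_mono => // x.
pose f z := psi c (x, z).
rewrite -(@mean_normalN _ _ _ _ Z mZ ZN f).
- rewrite le_eqVlt; apply/orP; left; apply/eqP; congr mean; apply/funext => w.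
  by apply: eq_vmax => l /=; ring.
- apply: measurableT_comp (mpsi c) _; exact: measurable_fun_pair.
- exact: ipsi1.
Qed.

(** With S frozen, [tau / kappa] is the scale for which the mean of |Z| restores tau. Moving that
    mean outside the maximum is Jensen's inequality; [vmax2_sym] then separates the scales c and -c,
    and [psiN] merges them, whence the factor 2. *)
Lemma gaussian_contraction :
  mean P (fun w => vmax2 (fun l l' => a l + a l' + tau * `|S l w - S l' w|)) <=
  2 * mean P (fun w => vmax (fun l => a l + tau / kappa * (Z w * S l w))).
Proof.
(* [f] ignores its second component; it is put on pairs to fit [indep_mean_mono]. *)
pose f (z : p.+1.-tuple R * R) :=
  vmax2 (fun l l' => a l + a l' + tau * `|tnth z.1 l - tnth z.1 l'|).
have -> : mean P (fun w => vmax2 (fun l l' => a l + a l' + tau * `|S l w - S l' w|)) =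
    mean P (fun w => f (tup S w, Z w)).
  congr mean; apply/funext => w; apply: eq_vmax => l; apply: eq_vmax => l'.
  by rewrite !tnth_mktuple.
have -> : mean P (fun w => vmax (fun l => a l + tau / kappa * (Z w * S l w))) =
    mean P (fun w => psi c (tup S w, Z w)).
  congr mean; apply/funext => w; apply: eq_vmax => l.
  by rewrite !tnth_mktuple.
apply: (@le_trans _ _ (mean P (fun w => psi c (tup S w, Z w) + psi (- c) (tup S w, Z w)))).
  2: by rewrite meanD//; have := psiN; lra.
have k0 := normal_abs_mean_gt0 R.
apply: (@indep_mean_mono _ _ _ P _ _ _ _ (tup S) Z f (fun z => psi c z + psi (- c) z)) => //.
- apply: (@mf_vmax R _ (p.+1.-tuple R * R)%type p (fun l z => vmax (fun l' =>
    a l + a l' + tau * `|tnth z.1 l - tnth z.1 l'|))) => l.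
  apply: (@mf_vmax R _ (p.+1.-tuple R * R)%type p (fun l' z =>
    a l + a l' + tau * `|tnth z.1 l - tnth z.1 l'|)) => l'.
  apply: measurable_funD => //; apply: measurable_funM => //.
  by apply: measurableT_comp => //; exact: measurable_funB.
- exact: measurable_funD.
- apply: (@itg_vmax2 (fun l l' w =>
    a l + a l' + tau * `|tnth (tup S w) l - tnth (tup S w) l'|)) => l l'.
  apply: itgD; first exact: itg_cst.
  apply: itgZ; under eq_fun do rewrite !tnth_mktuple.
  by apply: itg_abs; exact: itgB.
- exact: itgD.
- by move=> x; exact: (itg_cst P (f (x, 0))).
- by move=> x; exact: itgD.
move=> x; rewrite [leLHS](mean_cst P (f (x, 0))); apply: vmax2_le => l l'.
have -> : a l + a l' + tau * `|tnth x l - tnth x l'| =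
    mean P (fun w => a l + a l' + c * `|tnth x l - tnth x l'| * `|Z w|).
  rewrite meanD ?mean_cst ?meanZ; [|exact: itg_abs|exact: itg_cst|exact/itgZ/itg_abs].
  rewrite (mean_abs_normal mZ ZN) /c; field; exact: lt0r_neq0.
apply: mean_le; [|exact: itgD|].
  by apply: itgD; [exact: itg_cst|exact/itgZ/itg_abs].
move=> w; pose u l := c * (Z w * tnth x l).
have := le_vmax2 (fun l l' => a l + a l' + `|u l - u l'|) l l'.
rewrite vmax2_sym /= => H; apply: le_trans (le_trans H _).
  have c0 : 0 <= c by rewrite divr_ge0// ltW.
  by rewrite lerD2l /u -mulrBr -mulrBr normrM (ger0_norm c0) normrM mulrAC mulrA.
rewrite lerD2l le_eqVlt; apply/orP; left; apply/eqP.
by apply: eq_vmax => j; rewrite /u /= mulNr.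
Qed.

End gaussian_contraction.

(** * Symmetrization and contraction for a single edge *)

Section edge.
Context d (Omega : measurableType d) (R : realType) (P : probability Omega R).
Notation kappa := (normal_abs_mean R).
Variables (p : nat) (L : R) (f S T : 'I_p.+1 -> Omega -> R) (Z Z' : Omega -> R).
Hypothesis L0 : 0 <= L.
Hypotheses (ifl : forall l, itg P (f l)) (iS : forall l, itg P (S l))
  (iT : forall l, itg P (T l)).
Hypothesis flip : forall l l' w,
  `|f l w - f l' w| <= L * (`|S l w - S l' w| + `|T l w - T l' w|).
Hypotheses (mZ : measurable_fun setT Z) (mZ' : measurable_fun setT Z').
Hypothesis ZN : forall B : set R, measurable B -> P (Z @^-1` B) = normal_prob 0 1 B.
Hypothesis ZN' : forall B : set R, measurable B -> P (Z' @^-1` B) = normal_prob 0 1 B.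
Hypothesis SZ : indep2 P (tup S) Z.
Hypothesis TZ : indep2 P (tup T) Z'.
Variable a : 'I_p.+1 -> R.

Let b l l' := a l + a l'.
Let D l w := f l w - mean P (f l).
Let Delta l l' w := `|S l w - S l' w| + `|T l w - T l' w|.
Let U w := vmax2 (fun l l' => b l l' + 2 * (L * Delta l l' w)).

Let iD l : itg P (D l).
Proof. by apply: itgB => //; exact: itg_cst. Qed.

Let mD l : mean P (D l) = 0.
Proof. by rewrite meanB ?mean_cst ?subrr//; exact: itg_cst. Qed.

Let iDelta l l' : itg P (Delta l l').
Proof. by apply: itgD; apply: itg_abs; exact: itgB. Qed.

Let iU : itg P U.
Proof.
apply: (@itg_vmax2 _ _ _ P p (fun l l' w => b l l' + 2 * (L * Delta l l' w))) => l l'.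
by apply: itgD; [exact: itg_cst|do 2 apply: itgZ].
Qed.

(* The mean of [vmax (a - D)] is at least [vmax a], which plays the role of an
   independent copy in the symmetrization. *)
Let symmetrize : mean P (fun w => vmax (fun l => a l + D l w)) + vmax a <= mean P U.
Proof.
have iaD1 : itg P (fun w => vmax (fun l => a l + D l w)).
  by apply: itg_vmax => l; apply: itgD; [exact: itg_cst|].
have iaDN : itg P (fun w => vmax (fun l => a l - D l w)).
  by apply: itg_vmax => l; apply: itgB; [exact: itg_cst|].
have le_neg : vmax a <= mean P (fun w => vmax (fun l => a l - D l w)).
  apply: (le_trans _ (vmax_mean (X := fun l w => a l - D l w) _)) => [|l].
    by apply: vmaxS => l; rewrite meanB ?mean_cst ?mD ?subr0//; exact: itg_cst.
  by apply: itgB => //; exact: itg_cst.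
pose m l l' := mean P (Delta l l').
have mU : vmax2 (fun l l' => b l l' + 2 * (L * m l l')) <= mean P U.
  apply: vmax2_le => l l'.
  have -> : b l l' + 2 * (L * m l l') =
      mean P (fun w => b l l' + 2 * (L * Delta l l' w)).
    rewrite meanD ?mean_cst ?meanZ//; [exact: itgZ|exact: itg_cst|].
    by do 2 apply: itgZ.
  apply: mean_le => //; first by apply: itgD; [exact: itg_cst|do 2 apply: itgZ].
  by move=> w; exact: (le_vmax2 (fun l l' => b l l' + 2 * (L * Delta l l' w))).
suff : mean P (fun w => vmax (fun l => a l + D l w) + vmax (fun l => a l - D l w)) <=
       mean P U by rewrite meanD//; lra.
(* [vmax2_sym] joins the two maxima into one over pairs. The centered difference D_l - D_l' is
   bounded by L times [Delta] plus L times the mean of [Delta]; the midpoint inequality separates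
   these two, at the price of the factor 2 in [U]. *)
apply: (@le_trans _ _ (mean P (fun w =>
    2^-1 * (U w + vmax2 (fun l l' => b l l' + 2 * (L * m l l')))))).
  apply: mean_le; first exact: itgD.
    by apply: itgZ; apply: itgD => //; exact: itg_cst.
  move=> w; rewrite -vmax2_sym mulrC ler_pdivlMr// mulrC.
  apply: le_trans (vmax2_midpoint b (fun l l' => L * Delta l l' w) (fun l l' => L * m l l')).
  rewrite ler_pM2l//; apply: vmax2S => l l'; rewrite lerD2l.
  have -> : D l w - D l' w = (f l w - f l' w) - (mean P (f l) - mean P (f l')).
    by rewrite /D; ring.
  apply: (le_trans (ler_normB _ _)); rewrite lerD//.
  rewrite -meanB//; apply: le_trans (le_normr_Rintegral _ _) _ => //.
    exact: itgB.
  rewrite -[leLHS]/(mean P (fun w => `|f l w - f l' w|)) -meanZ//.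
  apply: mean_le => //; first by apply: itg_abs; exact: itgB.
  exact: itgZ.
rewrite meanZ; last by apply: itgD => //; exact: itg_cst.
by rewrite meanD ?mean_cst//; [lra|exact: itg_cst].
Qed.

(** The factor 8 is three convexity splittings, each doubling the scale: random part from its mean
    in [symmetrize], S from T in [edge_bound], and [vmax a] from the Gaussian term by
    [vmax_double]. *)
Let c := 2 * (4 * L / kappa).

Let iaS : itg P (fun w => vmax (fun l => a l + c * (Z w * S l w))).
Proof.
apply: itg_vmax => l; apply: itgD; first exact: itg_cst.
by apply: itgZ; exact: itg_noise.
Qed.

Let iaT : itg P (fun w => vmax (fun l => a l + c * (Z' w * T l w))).
Proof.
apply: itg_vmax => l; apply: itgD; first exact: itg_cst.
by apply: itgZ; exact: itg_noise.
Qed.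

(** The midpoint inequality treats S and T separately, so the bound is an average of two
    one-endpoint terms. Each contributes a [vmax a], and together they cancel the one that
    [symmetrize] adds on the left. *)
Lemma edge_bound :
  mean P (fun w => vmax (fun l => a l + (f l w - mean P (f l)))) <=
  2^-1 * (mean P (fun w => vmax (fun l => a l + c * (Z w * S l w))) +
          mean P (fun w => vmax (fun l => a l + c * (Z' w * T l w)))).
Proof.
have L4 : 0 <= 4 * L by rewrite mulr_ge0.
have contract (X : 'I_p.+1 -> Omega -> R) (Y : Omega -> R) :
    (forall l, itg P (X l)) -> measurable_fun setT Y ->
    (forall B : set R, measurable B -> P (Y @^-1` B) = normal_prob 0 1 B) ->
    indep2 P (tup X) Y ->
    mean P (fun w => vmax2 (fun l l' => b l l' + 2 * (2 * L * `|X l w - X l' w|)))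
    <= vmax a + mean P (fun w => vmax (fun l => a l + c * (Y w * X l w))).
  move=> iX mY YN XY.
  have iN l : itg P (fun w => Y w * X l w) by exact: itg_noise.
  have iv (e : R) : itg P (fun w => vmax (fun l => a l + e * (Y w * X l w))).
    by apply: itg_vmax => l; apply: itgD; [exact: itg_cst|exact: itgZ].
  have := gaussian_contraction iX mY YN XY a L4.
  rewrite [X in X <= _ -> _](_ : _ =
      mean P (fun w => vmax2 (fun l l' => b l l' + 2 * (2 * L * `|X l w - X l' w|)))).
    move/le_trans; apply; rewrite -meanZ// -(mean_cst P (vmax a)) -meanD//.
      2: exact: itg_cst.
    apply: mean_le; [exact: itgZ|by apply: itgD; [exact: itg_cst|]|].
    move=> w; apply: le_trans (vmax_double _ _) _; rewrite lerD2l.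
    by rewrite le_eqVlt; apply/orP; left; apply/eqP; apply: eq_vmax => l; rewrite /c mulrA.
  congr mean; apply/funext => w; apply: eq_vmax => l; apply: eq_vmax => l'.
  by rewrite /b; ring.
have iX (X : 'I_p.+1 -> Omega -> R) : (forall l, itg P (X l)) ->
    itg P (fun w => vmax2 (fun l l' => b l l' + 2 * (2 * L * `|X l w - X l' w|))).
  move=> iX; apply: (@itg_vmax2 _ _ _ P p (fun l l' w =>
    b l l' + 2 * (2 * L * `|X l w - X l' w|))) => l l'.
  apply: itgD; first exact: itg_cst.
  by do 2 apply: itgZ; apply: itg_abs; exact: itgB.
have US : 2 * mean P U <=
    mean P (fun w => vmax2 (fun l l' => b l l' + 2 * (2 * L * `|S l w - S l' w|))) +
    mean P (fun w => vmax2 (fun l l' => b l l' + 2 * (2 * L * `|T l w - T l' w|))).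
  rewrite -meanD ?iX// -meanZ//; apply: mean_le; [exact: itgZ|by apply: itgD; exact: iX|].
  move=> w; rewrite /U; apply: le_trans (vmax2_midpoint _ _ _).
  rewrite ler_pM2l// le_eqVlt; apply/orP; left; apply/eqP.
  by apply: eq_vmax => l; apply: eq_vmax => l'; rewrite /Delta; ring.
have cS := contract S Z iS mZ ZN SZ.
have cT := contract T Z' iT mZ' ZN' TZ.
by have := symmetrize; rewrite -/(D _ _); lra.
Qed.

End edge.

(** * Measurability of Lipschitz kernels *)

Section lipschitz_measurable.
Context (R : realType).

Lemma sqrt_sum4_le (a b c e : R) :
  Num.sqrt (a ^+ 2 + b ^+ 2 + c ^+ 2 + e ^+ 2) <= `|a| + `|b| + `|c| + `|e|.
Proof.
have s0 : 0 <= `|a| + `|b| + `|c| + `|e| by rewrite !addr_ge0.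
rewrite -[leRHS](ger0_norm s0) -sqrtr_sqr ler_wsqrtr//.
rewrite -(real_normK (num_real a)) -(real_normK (num_real b)).
rewrite -(real_normK (num_real c)) -(real_normK (num_real e)).
have := normr_ge0 a; have := normr_ge0 b; have := normr_ge0 c; have := normr_ge0 e.
move: `|a| `|b| `|c| `|e| => x y z t t0 z0 y0 x0.
rewrite -subr_ge0 (_ : _ - _ = 2 * (x * y + x * z + x * t + y * z + y * t + z * t)).
  by rewrite mulr_ge0// !addr_ge0// mulr_ge0.
by ring.
Qed.

Variables (L : R) (h : R * R -> R * R -> R).
Hypotheses (L0 : 0 < L) (hlip : lipschitz_kernel L h).

Let dist1 (z q : R * R * (R * R)) :=
  `|z.1.1 - q.1.1| + `|z.1.2 - q.1.2| + `|z.2.1 - q.2.1| + `|z.2.2 - q.2.2|.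

Lemma lipschitz_kernel_dist1 (z q : R * R * (R * R)) :
  `|h z.1 z.2 - h q.1 q.2| <= L * dist1 z q.
Proof.
by apply: (le_trans (hlip _ _ _ _)); rewrite ler_pM2l// sqrt_sum4_le.
Qed.

Let rat4 : Type := (rat * rat * (rat * rat))%type.
Let ratr4 (q : rat4) : R * R * (R * R) :=
  (ratr q.1.1, ratr q.1.2, (ratr q.2.1, ratr q.2.2)).

Let rat_close (t e : R) : 0 < e -> exists q : rat, `|t - ratr q| < e.
Proof.
move=> e0; have te : t - e < t + e by lra.
have [q] := rat_in_itvoo te; rewrite in_itv/= => /andP[q1 q2].
by exists q; rewrite ltr_norml; apply/andP; split; lra.
Qed.

(* h is the infimum over the rational points q of h q + L dist1(_, q). *)
Lemma measurable_lipschitz_kernel :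
  measurable_fun setT (fun z : R * R * (R * R) => h z.1 z.2).
Proof.
apply: (measurability _ (RGenInftyO.measurableE R)) => //.
move=> _ [_ [y ->] <-]; rewrite setTI.
have -> : (fun z : R * R * (R * R) => h z.1 z.2) @^-1` `]-oo, y[ =
    \bigcup_(q in [set: rat4])
      [set z | h (ratr4 q).1 (ratr4 q).2 + L * dist1 z (ratr4 q) < y].
  apply/seteqP; split => [z|z [q _ /=]] /=; rewrite in_itv/=.
    (* Four coordinates within e make L times the distance less than half the gap y - h z. That half
       is spent twice, once to compare h at q with h at z and once for the added distance term. *)
    move=> hy; pose e := (y - h z.1 z.2) / (8 * L).
    have e0 : 0 < e by rewrite divr_gt0 ?subr_gt0 ?mulr_gt0.
    have [q1 Q1] := rat_close z.1.1 e0; have [q2 Q2] := rat_close z.1.2 e0.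
    have [q3 Q3] := rat_close z.2.1 e0; have [q4 Q4] := rat_close z.2.2 e0.
    exists ((q1, q2), (q3, q4)) => //=; set q := ratr4 _.
    have dq : dist1 z q < 4 * e by rewrite /dist1 /=; lra.
    have : L * dist1 z q < L * (4 * e) by rewrite ltr_pM2l.
    have -> : L * (4 * e) = (y - h z.1 z.2) / 2 by rewrite /e; field; exact: lt0r_neq0.
    have := lipschitz_kernel_dist1 z q; rewrite ler_norml => /andP[].
    by rewrite /=; lra.
  have := lipschitz_kernel_dist1 z (ratr4 q); rewrite ler_norml => /andP[].
  by rewrite /=; lra.
apply: countable_bigcupT_measurable => [|q].
  exact: (@countableP (rat * rat * (rat * rat))%type).
have mproj (f : R * R * (R * R) -> R) (r : R) : measurable_fun setT f ->
    measurable_fun setT (fun z => `|f z - r|).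
  by move=> mf; apply: measurableT_comp => //; exact: measurable_funB.
have mf : measurable_fun setT (fun z : R * R * (R * R) =>
    h (ratr4 q).1 (ratr4 q).2 + L * dist1 z (ratr4 q)).
  apply: measurable_funD => //; apply: measurable_funM => //.
  apply: measurable_funD; [apply: measurable_funD; [apply: measurable_funD|]|];
    apply: mproj.
  - exact: measurableT_comp measurable_fst measurable_fst.
  - exact: measurableT_comp measurable_snd measurable_fst.
  - exact: measurableT_comp measurable_fst measurable_snd.
  - exact: measurableT_comp measurable_snd measurable_snd.
have -> : [set z | h (ratr4 q).1 (ratr4 q).2 + L * dist1 z (ratr4 q) < y] =
    (fun z => h (ratr4 q).1 (ratr4 q).2 + L * dist1 z (ratr4 q)) @^-1` `]-oo, y[.
  by apply/seteqP; split => z; rewrite /= in_itv.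
by rewrite -[X in measurable X]setTI; exact: mf.
Qed.

End lipschitz_measurable.

(** * Degrees and edge colourings of nearest-neighbour graphs *)

Section greedy_coloring.
Local Open Scope nat_scope.

Lemma greedy_coloring (T : finType) (e : rel T) (K : nat) :
  symmetric e -> (forall x, #|[set y | e x y]%SET| < K) ->
  exists f : T -> 'I_K, forall x y, e x y -> x != y -> f x != f y.
Proof.
move=> esym; case: K => [|K] degK.
  (* With no colours the degree hypothesis is contradictory at any vertex, so T is empty. *)
  exists (fun x : T => False_rect _ (notF (degK x))) => x.
  by have := degK x.
suff [f Hf] : exists f : T -> 'I_K.+1, {in enum T &, forall x y,
    e x y -> x != y -> f x != f y}.
  by exists f => x y; apply: Hf; rewrite mem_enum.
elim: (enum T) => [|x r [f Hf]]; first by exists (fun=> ord0).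
(* The neighbours of x are fewer than the colours, so one colour is free for x. *)
have [c cP] : exists c : 'I_K.+1, c \notin [set f y | y in [set y | e x y]%SET]%SET.
  apply/existsP; rewrite -negb_forall; apply/negP => /forallP H.
  have := leq_imset_card f [set y | e x y]%SET.
  have -> : [set f y | y in [set y | e x y]]%SET = [set: 'I_K.+1]%SET.
    by apply/finset.setP => c; rewrite H finset.inE.
  by rewrite cardsT card_ord leqNgt degK.
have fc y : e x y -> f y != c.
  move=> exy; apply: contraNneq cP => <-.
  by apply: imset_f; rewrite finset.inE.
exists (fun y => if y == x then c else f y) => y z.
rewrite !inE; have [->|yx] := eqVneq y x => /=; have [->|zx] := eqVneq z x => //=.
- by move=> _ _ /fc; rewrite eq_sym.
- by move=> _ _; rewrite esym => /fc.
- exact: Hf.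
Qed.

End greedy_coloring.

(** * In-degrees of nearest-neighbour graphs *)

Section knn_degree.
Context (R : realType).

Definition dist2 d (x y : 'rV[R]_d) : R := \sum_(c < d) (x ord0 c - y ord0 c) ^+ 2.

Lemma dist2_ge0 d (x y : 'rV[R]_d) : 0 <= dist2 x y.
Proof. by apply: sumr_ge0 => c _; rewrite sqr_ge0. Qed.

Lemma dist2C d (x y : 'rV[R]_d) : dist2 x y = dist2 y x.
Proof. by apply: eq_bigr => c _; rewrite -sqrrN opprB. Qed.

Lemma edist_gt0 d (x y : 'rV[R]_d) : x != y -> 0 < Defs.edist x y.
Proof.
move=> xy; rewrite sqrtr_gt0 lt_neqAle dist2_ge0 andbT eq_sym.
apply: contra xy => /eqP d0; apply/eqP/rowP => c.
have := psumr_eq0P (fun c _ => sqr_ge0 (x ord0 c - y ord0 c)) d0 (i := c) isT.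
by move/eqP; rewrite sqrf_eq0 subr_eq0 => /eqP.
Qed.

(* Two points seen from z within an angle of less than 60 degrees are closer to each
   other than the farther one is to z. *)
Lemma dist2_lt_of_close_directions d (x y z : 'rV[R]_d) :
  x != z -> y != z -> Defs.edist z x <= Defs.edist z y ->
  \sum_(c < d) ((x ord0 c - z ord0 c) / Defs.edist z x -
                (y ord0 c - z ord0 c) / Defs.edist z y) ^+ 2 < 1 ->
  dist2 y x < dist2 y z.
Proof.
move=> xz yz rs.
have r0 : 0 < Defs.edist z x by apply: edist_gt0; rewrite eq_sym.
have s0 : 0 < Defs.edist z y by apply: edist_gt0; rewrite eq_sym.
have r2 : dist2 z x = Defs.edist z x ^+ 2 by rewrite sqr_sqrtr// dist2_ge0.
have s2 : dist2 z y = Defs.edist z y ^+ 2 by rewrite sqr_sqrtr// dist2_ge0.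
rewrite (dist2C y z) s2; move: r2 s2 rs r0 s0.
set r := Defs.edist z x; set s := Defs.edist z y => r2 s2 rs r0 s0.
pose u c := (x ord0 c - z ord0 c) / r; pose v c := (y ord0 c - z ord0 c) / s.
rewrite -[X in X < 1 -> _]/(\sum_(c < d) (u c - v c) ^+ 2) => uv.
have u1 : \sum_(c < d) u c ^+ 2 = 1.
  rewrite (eq_bigr (fun c => (z ord0 c - x ord0 c) ^+ 2 * r ^- 2)).
    by rewrite -mulr_suml -[X in X / _]/(dist2 z x) r2 divff// expf_neq0// gt_eqF.
  by move=> c _; rewrite /u; field; rewrite gt_eqF.
have v1 : \sum_(c < d) v c ^+ 2 = 1.
  rewrite (eq_bigr (fun c => (z ord0 c - y ord0 c) ^+ 2 * s ^- 2)).
    by rewrite -mulr_suml -[X in X / _]/(dist2 z y) s2 divff// expf_neq0// gt_eqF.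
  by move=> c _; rewrite /v; field; rewrite gt_eqF.
(* Law of cosines for y - x = s v - r u. For unit u, v it reads (s - r)^2 + r s |u - v|^2, which is
   below s^2 when |u - v| < 1 and r <= s. *)
have -> : dist2 y x = s * (s - r) * (\sum_(c < d) v c ^+ 2) +
    r * (r - s) * (\sum_(c < d) u c ^+ 2) +
    r * s * \sum_(c < d) (u c - v c) ^+ 2.
  rewrite !mulr_sumr -!big_split /=; apply: eq_bigr => c _.
  by rewrite /u /v; field; rewrite !gt_eqF.
rewrite u1 v1 !mulr1.
have : r * s * (\sum_(c < d) (u c - v c) ^+ 2) < r * s * 1.
  by rewrite ltr_pM2l// mulr_gt0.
by move: (\sum_(c < d) _) => t; nra.
Qed.

(** These cells play the role of cones. A coordinate of the unit direction lies in [-1, 1]; shifted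
    by 1 and scaled by d it falls in one of 2 d + 1 unit cells. Two directions with the same code
    differ by less than 1/d in each coordinate, hence by less than 1 in squared norm. *)
Definition direction_code d (z x : 'rV[R]_d) : {ffun 'I_d -> 'I_(2 * d).+1} :=
  [ffun c => inord (Num.truncn (d%:R * ((x ord0 c - z ord0 c) / Defs.edist z x + 1)))].

Lemma direction_code_close d (x y z : 'rV[R]_d) : (0 < d)%N ->
  x != z -> y != z -> direction_code z x = direction_code z y ->
  \sum_(c < d) ((x ord0 c - z ord0 c) / Defs.edist z x -
                (y ord0 c - z ord0 c) / Defs.edist z y) ^+ 2 < 1.
Proof.
move=> d0 xz yz /ffunP code.
have dir x' c : x' != z -> -1 <= (x' ord0 c - z ord0 c) / Defs.edist z x' <= 1.
  move=> xz'; have r0 : 0 < Defs.edist z x' by apply: edist_gt0; rewrite eq_sym.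
  rewrite -ler_norml normrM normfV (gtr0_norm r0) ler_pdivrMr// mul1r.
  rewrite -sqrtr_sqr ler_wsqrtr// (bigD1 c)//= -[X in X <= _]sqrrN opprB lerDl.
  by apply: sumr_ge0 => j _; rewrite sqr_ge0.
have dR : 0 < d%:R :> R by rewrite ltr0n.
have close c : ((x ord0 c - z ord0 c) / Defs.edist z x -
    (y ord0 c - z ord0 c) / Defs.edist z y) ^+ 2 < d%:R^-1 ^+ 2.
  have := code c; rewrite !ffunE.
  have := dir x c xz; have := dir y c yz.
  move: (_ / Defs.edist z y) (_ / Defs.edist z x) => v u v1 u1.
  have s0 (t : R) : -1 <= t <= 1 -> 0 <= d%:R * (t + 1).
    by move=> /andP[t1 _]; rewrite mulr_ge0 ?ler0n//; lra.
  have bnd (t : R) : -1 <= t <= 1 -> (Num.truncn (d%:R * (t + 1)) < (2 * d).+1)%N.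
    move=> t1; have /andP[t0 _] := truncn_itv (s0 t t1).
    rewrite ltnS -(ler_nat R) (le_trans t0)// natrM mulrC ler_pM2r//.
    by case/andP: t1 => _ t1; lra.
  move=> /(congr1 val); rewrite /= !inordK ?bnd// => E.
  have /andP[] := truncn_itv (s0 u u1); have /andP[] := truncn_itv (s0 v v1).
  rewrite E -!natr1; set t := (Num.truncn _)%:R => tv vt tu ut.
  have duv : (d%:R * (u - v)) ^+ 2 < 1 by nra.
  rewrite -(ltr_pM2l (x := d%:R ^+ 2)) ?exprn_gt0// -exprMn.
  by rewrite -exprMn divff ?gt_eqF// expr1n.
apply: (@lt_le_trans _ _ (\sum_(c < d) d%:R^-1 ^+ 2)).
  apply: ltr_sum => //.
  by apply/hasP; exists (Ordinal d0) => //; exact: mem_index_enum.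
rewrite sumr_const card_ord -[X in X <= _]mulr_natr expr2 -mulrA mulVf ?gt_eqF// mulr1.
by rewrite invf_le1// ler1n.
Qed.

Lemma knn_indegree d (n k : nat) (x : 'I_n -> 'rV[R]_d) (N : 'I_n -> {set 'I_n})
  (i : 'I_n) : (0 < d)%N -> (0 < k)%N -> injective x -> knn_graph k x N ->
  (#|[set j | i \in N j]%SET| <= #|{: {ffun 'I_d -> 'I_(2 * d).+1}}| * (2 * k))%N.
Proof.
move=> d0 k0 xinj knn.
pose code j := direction_code (x i) (x j).
pose S := [set j | i \in N j]%SET.
rewrite -/S -sum1_card (partition_big code xpredT)//=.
rewrite -sum_nat_const; apply: leq_sum => q _; rewrite sum1dep_card.
pose Q := [set j | (j \in S) && (code j == q)]%SET; rewrite -/Q.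
have [->|[j0 j0Q]] := set_0Vmem Q; first by rewrite cards0.
pose r j := Defs.edist (x i) (x j).
have [js jsQ jsmax] : exists2 js, js \in Q & forall j, j \in Q -> r j <= r js.
  by case: (@Order.TotalTheory.arg_maxP _ _ _ j0 (mem Q) r) => // js jsQ H; exists js.
have ne j : j \in Q -> x j != x i.
  rewrite !finset.inE => /andP[ij _]; apply/eqP => /xinj E.
  by subst j; have [+ _ _] := knn i; rewrite ij.
have sub : Q \subset (js |: N js)%SET.
  apply/fintype.subsetP => j jQ; rewrite finset.in_setU1.
  (* Were j outside [N js], the neighbour i of js would be at least as close to js as j is, against
     [dist2_lt_of_close_directions]. *)
  have [//|jjs] := eqVneq j js; rewrite /=; apply/negPn/negP => jN.
  have [_ _ nn] := knn js.
  have := jsQ; rewrite !finset.inE => /andP[iN _].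
  have := nn _ _ iN jN jjs; rewrite ler_sqrt ?dist2_ge0//.
  apply/negP; rewrite -ltNge; apply: dist2_lt_of_close_directions.
  - exact: ne.
  - exact: ne.
  - exact: jsmax.
  apply: direction_code_close => //; [exact: ne|exact: ne|].
  have := jQ; have := jsQ; rewrite !finset.inE => /andP[_ /eqP <-] /andP[_ /eqP].
  exact.
apply: (leq_trans (subset_leq_card sub)); apply: (leq_trans (leq_card_setU _ _)).
(* The class has at most 1 + k points, and 1 + k <= 2 k since k is positive. *)
have [_ -> _] := knn js; rewrite cards1 mul2n -addnn leq_add2r//.
Qed.

End knn_degree.

(** * Splitting the edges into matchings *)

Section edge_coloring.
Variables (n : nat) (N : 'I_n -> {set 'I_n}).
Local Open Scope nat_scope.

Definition share_vertex (e e' : 'I_n * 'I_n) :=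
  [|| e.1 == e'.1, e.1 == e'.2, e.2 == e'.1 | e.2 == e'.2].

(** Edges are ordered pairs: the reciprocal edges i -> j and j -> i are distinct, share their
    vertices, and so end up in different matchings. *)
Definition adjacent_edges (e e' : 'I_n * 'I_n) :=
  [&& e.2 \in N e.1, e'.2 \in N e'.1 & share_vertex e e'].

Let incident (v : 'I_n) : {set 'I_n * 'I_n} :=
  ([set (v, j) | j in N v] :|: [set (j, v) | j in [set j | v \in N j]])%SET.

Let card_incident v : #|incident v| <= degree N v.
Proof.
by apply: (leq_trans (leq_card_setU _ _)); rewrite leq_add// leq_imset_card.
Qed.

Let incidentP (v : 'I_n) (e : 'I_n * 'I_n) : e.2 \in N e.1 -> (e.1 == v) || (e.2 == v) ->
  e \in incident v.
Proof.
case: e => i j /= ij /orP[/eqP iv|/eqP jv]; rewrite finset.in_setU; apply/orP.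
  by left; apply/imsetP; exists j; rewrite -iv.
by right; apply/imsetP; exists i; rewrite ?finset.inE -jv.
Qed.

(** An edge meets only edges incident to one of its two endpoints, at most 2 D of them, so one more
    colour suffices for the greedy choice. *)
Lemma edge_coloring (D : nat) : (forall v, degree N v <= D) ->
  exists f : 'I_n * 'I_n -> 'I_(2 * D).+1,
    forall e e', adjacent_edges e e' -> e != e' -> f e != f e'.
Proof.
move=> degD; apply: greedy_coloring => [e e'|e].
  rewrite /adjacent_edges /share_vertex andbCA; congr [&& _, _ & _].
  by rewrite !(eq_sym e'.1) !(eq_sym e'.2); do 4 case: (_ == _).
rewrite ltnS (@leq_trans #|(incident e.1 :|: incident e.2)%SET|)//; last first.
  apply: (leq_trans (leq_card_setU _ _)).
  by rewrite mul2n -addnn leq_add// (leq_trans (card_incident _)).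
apply: subset_leq_card; apply/fintype.subsetP => e'; rewrite finset.inE => /and3P[_ e'N].
rewrite finset.in_setU => /or4P[] /eqP E; apply/orP.
- by left; apply: incidentP => //; rewrite E eqxx.
- by left; apply: incidentP => //; rewrite E eqxx orbT.
- by right; apply: incidentP => //; rewrite E eqxx.
- by right; apply: incidentP => //; rewrite E eqxx orbT.
Qed.

End edge_coloring.

Lemma knn_edge_coloring (d : nat) : (0 < d)%N ->
  exists2 K : nat, (0 < K)%N & forall (R : realType) (n k : nat) (x : 'I_n -> 'rV[R]_d)
    (N : 'I_n -> {set 'I_n}), (0 < k)%N -> injective x -> knn_graph k x N ->
  exists f : 'I_n * 'I_n -> 'I_(K * k),
    forall e e', adjacent_edges N e e' -> e != e' -> f e != f e'.
Proof.
move=> d0; pose M := #|{: {ffun 'I_d -> 'I_(2 * d).+1}}|.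
(* Degrees are at most k + M (2 k), which calls for 2 (1 + 2 M) k + 1 colours; the final 1 is
   rounded up to k to get a multiple of k. *)
exists (2 * (1 + 2 * M) + 1)%N => [|R n k x N k0 xinj knn]; first by rewrite addn1.
have [v|f fP] := @edge_coloring n N ((1 + 2 * M) * k).
  rewrite /degree mulnDl mul1n -mulnA mulnCA leq_add//.
    by have [_ -> _] := knn v.
  exact: (knn_indegree v d0 k0 xinj knn).
have le : ((2 * ((1 + 2 * M) * k)).+1 <= (2 * (1 + 2 * M) + 1) * k)%N.
  by rewrite [X in (_ <= X)%N]mulnDl mul1n mulnA -addn1 leq_add2l.
by exists (fun e => widen_ord le (f e)) => e e' ee' /fP; exact.
Qed.

(** * Finite families of functions *)

Section vertex_steps.
Context d (Omega : measurableType d) (R : realType) (P : probability Omega R).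
Variables (I : finType) (F : I -> set (set Omega)) (p : nat).
Hypothesis Fm : forall s, F s `<=` measurable.
Hypothesis FT : forall s, F s setT.
Hypothesis FI : forall s, setI_closed (F s).
Hypothesis Findep : independent_systems P F.
Implicit Types (X Y : 'I_p.+1 -> Omega -> R) (a : 'I_p.+1 -> R).

Lemma vmax_le_mean_centered X a : (forall l, itg P (X l)) ->
  (forall l, mean P (X l) = 0) ->
  vmax a <= mean P (fun w => vmax (fun l => a l + X l w)).
Proof.
move=> iX X0; apply: (le_trans _ (vmax_mean (X := fun l w => a l + X l w) _)) => [|l].
  by apply: vmaxS => l; rewrite meanD ?mean_cst ?X0 ?addr0//; exact: itg_cst.
by apply: itgD => //; exact: itg_cst.
Qed.

(** Jensen's inequality in Y with X frozen, phrased as the replacement of the zero block by Y. *)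
Lemma mean_vmax_add_centered (J K : {set I}) X Y a :
  (forall s, s \in J -> s \notin K) ->
  (forall l, sub_measurable F J (X l)) -> (forall l, sub_measurable F K (Y l)) ->
  (forall l, itg P (X l)) -> (forall l, itg P (Y l)) -> (forall l, mean P (Y l) = 0) ->
  mean P (fun w => vmax (fun l => a l + X l w)) <=
  mean P (fun w => vmax (fun l => a l + (X l w + Y l w))).
Proof.
move=> dJK mX mY iX iY Y0.
rewrite (eq_mean_vmax _ (Y := fun l w => (a l + X l w) + 0)); last first.
  by move=> w l; rewrite addr0.
rewrite [leRHS](eq_mean_vmax _ (Y := fun l w => (a l + X l w) + Y l w)); last first.
  by move=> w l; rewrite addrA.
apply: (@replace_block _ _ _ _ _ _ Fm FT FI Findep p J K (fun l w => a l + X l w)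
  (fun _ _ => 0) Y) => //.
- by move=> l; apply: sub_measurableD => //; exact: measurable_cst.
- by move=> l; exact: measurable_cst.
- by move=> l; apply: itgD => //; exact: itg_cst.
- by move=> l; exact: itg_cst.
move=> b; rewrite (eq_mean_vmax _ (Y := fun l w => b l)) => [|w l]; last by rewrite addr0.
by rewrite mean_cst; exact: vmax_le_mean_centered.
Qed.

(** The expected maximum is convex in the scale and, X being centered, at least its value [vmax a]
    at scale 0; hence it cannot decrease from s to t. *)
Lemma mean_vmax_scale X a (s t : R) : 0 <= s <= t ->
  (forall l, itg P (X l)) -> (forall l, mean P (X l) = 0) ->
  mean P (fun w => vmax (fun l => a l + s * X l w)) <=
  mean P (fun w => vmax (fun l => a l + t * X l w)).
Proof.
move=> /andP[s0 st] iX X0.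
have iv e : itg P (fun w => vmax (fun l => a l + e * X l w)).
  by apply: itg_vmax => l; apply: itgD; [exact: itg_cst|exact: itgZ].
have [t0|t0] := eqVneq t 0; first by have -> : s = t by lra.
have tp : 0 < t by lra.
have at_ : vmax a <= mean P (fun w => vmax (fun l => a l + t * X l w)).
  apply: vmax_le_mean_centered => l; first exact: itgZ.
  by rewrite meanZ// X0 mulr0.
pose r := s / t; have r01 : 0 <= r <= 1.
  by rewrite /r ler_pdivrMr// mul1r st andbT divr_ge0// ltW.
apply: (@le_trans _ _ (mean P (fun w => (1 - r) * vmax a +
    r * vmax (fun l => a l + t * X l w)))).
  apply: mean_le => //.
    by apply: itgD; [exact: itg_cst|exact: itgZ].
  move=> w; have [l ->] := vmaxP (fun l => a l + s * X l w).
  have := le_vmax a l; have := le_vmax (fun l => a l + t * X l w) l => /=.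
  have -> : s = r * t by rewrite /r divfK.
  by move: (vmax _) (vmax _) (a l) (X l w) => A B u v; nra.
rewrite meanD ?mean_cst ?meanZ//; [|exact: itg_cst|exact: itgZ].
by move: (mean _ _) at_ => M; nra.
Qed.

Lemma vmax_sum (T : Type) (r : seq T) (Y : T -> 'I_p.+1 -> R) :
  vmax (fun l => \sum_(t <- r) Y t l) <= \sum_(t <- r) vmax (Y t).
Proof.
elim: r => [|t r IH].
  by rewrite big_nil; apply: vmax_le => l; rewrite big_nil.
rewrite big_cons; apply: le_trans (lerD (lexx _) IH).
by apply: le_trans (vmaxD _ _); apply: vmaxS => l; rewrite big_cons.
Qed.

End vertex_steps.

(** * Assembly over edges, matchings and vertices *)

Section finite_family.
Context (R : realType) (L : R) (d n m k K p : nat).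
Variables (x : 'I_n -> 'rV[R]_d) (N : 'I_n -> {set 'I_n}) (h : R * R -> R * R -> R).
Context (disp : measure_display) (Omega : measurableType disp) (P : probability Omega R).
Variables (V : 'I_n -> {RV P >-> (m.-tuple R * R)%type}) (Z : 'I_n -> {RV P >-> R}).
Variables (g : 'I_p.+1 -> m.-tuple R -> 'rV[R]_d -> R).
Notation kappa := (normal_abs_mean R).
Hypotheses (hL : 0 < L) (n0 : (0 < n)%N) (k0 : (0 < k)%N).
Hypothesis Nirr : forall i, i \notin N i.
Hypothesis hlip : lipschitz_kernel L h.
Hypothesis ZN : forall (i : 'I_n) (B : set R), measurable B ->
  distribution P (Z i) B = normal_prob 0 1 B.
Let F (s : 'I_n + 'I_n) : set (set Omega) :=
  match s with inl i => events_of (V i) | inr i => events_of (Z i) end.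
Hypothesis Findep : independent_systems P F.
Hypothesis mg : forall l i, measurable_fun setT (fun e : m.-tuple R => g l e (x i)).
Hypothesis ig : forall l i, P.-integrable setT (fun w => (g l (V i w).1 (x i))%:E).
Hypothesis ih : forall l (i j : 'I_n), j \in N i ->
  P.-integrable setT (fun w => (h (Wpair x V (g l) i w) (Wpair x V (g l) j w))%:E).
Variable col : 'I_n * 'I_n -> 'I_(K * k).
Hypothesis colP : forall e e', adjacent_edges N e e' -> e != e' -> col e != col e'.

Let Fm s : F s `<=` measurable.
Proof.
by case: s => i A [B mB <-]; exact: (measurable_funPT _ measurableT _ mB).
Qed.

Let FT s : F s setT.
Proof. by case: s => i; exists setT; rewrite ?preimage_setT ?setTI. Qed.

Let FI s : setI_closed (F s).
Proof.
by case: s => i _ _ [A mA <-] [B mB <-]; exists (A `&` B);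
  rewrite ?setTI ?preimage_setI//; exact: measurableI.
Qed.

Let S (i : 'I_n) (l : 'I_p.+1) (w : Omega) : R := g l (V i w).1 (x i).
Let zeta i l w := Z i w * S i l w.
Let c := 2 * (4 * L / kappa).

Let smV (J : {set 'I_n + 'I_n}) i : inl i \in J -> sub_measurable F J (V i).
Proof. by move=> iJ; exact: sub_measurable_events iJ _. Qed.

Let smZ (J : {set 'I_n + 'I_n}) i : inr i \in J -> sub_measurable F J (Z i).
Proof. by move=> iJ; exact: sub_measurable_events iJ _. Qed.

Let smS (J : {set 'I_n + 'I_n}) i l : inl i \in J -> sub_measurable F J (S i l).
Proof.
move=> iJ; apply: measurableT_comp (mg l i) _.
by apply: measurableT_comp; [exact: measurable_fst|exact: smV].
Qed.

Let smzeta (J : {set 'I_n + 'I_n}) i l : inl i \in J -> inr i \in J ->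
  sub_measurable F J (zeta i l).
Proof. by move=> iJ iJ'; apply: measurable_funM; [exact: smZ|exact: smS]. Qed.

Let SZ i : indep2 P (tup (S i)) (Z i).
Proof.
apply: (@sub_measurable_indep _ _ _ P _ F Fm FT FI Findep _ _ _ _
  [set inl i]%SET [set inr i]%SET).
- by move=> s; rewrite !finset.in_set1 => /eqP->.
- by apply: sub_measurable_tup => l; apply: smS; rewrite finset.in_set1.
- by apply: smZ; rewrite finset.in_set1.
Qed.

Let iS i l : itg P (S i l). Proof. exact: ig. Qed.

Let mZ i : measurable_fun setT (Z i). Proof. exact: measurable_funPT. Qed.

Let izeta i l : itg P (zeta i l).
Proof. exact: (itg_noise (iS i) (mZ i) (ZN i) (SZ i)). Qed.

Let zeta0 i l : mean P (zeta i l) = 0.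
Proof. exact: (mean_noise (iS i) (mZ i) (ZN i) (SZ i)). Qed.

Let f (e : 'I_n * 'I_n) l w := h (Wpair x V (g l) e.1 w) (Wpair x V (g l) e.2 w).

(** Zero off the edges, because [replace_blocks] asks for integrable blocks at every index while
    [ih] covers edges only. *)
Let D (e : 'I_n * 'I_n) l w := if e.2 \in N e.1 then f e l w - mean P (f e l) else 0.
Let D' (e : 'I_n * 'I_n) l w := c * zeta e.1 l w + c * zeta e.2 l w.

(** The Y coordinates are the same for l and l' and drop out of the Lipschitz bound. *)
Let flip e l l' w :
  `|f e l w - f e l' w| <= L * (`|S e.1 l w - S e.1 l' w| + `|S e.2 l w - S e.2 l' w|).
Proof.
have := lipschitz_kernel_dist1 hL hlip
  (Wpair x V (g l) e.1 w, Wpair x V (g l) e.2 w)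
  (Wpair x V (g l') e.1 w, Wpair x V (g l') e.2 w).
by rewrite /= !subrr !normr0 add0r addr0.
Qed.

(** [edge_bound] gives an average of two bounds with noise at one endpoint; adding the independent
    centered noise of the other endpoint makes both equal to the right-hand side. *)
Let edge_step e (a : 'I_p.+1 -> R) : e.2 \in N e.1 ->
  mean P (fun w => vmax (fun l => a l + D e l w)) <=
  mean P (fun w => vmax (fun l => a l + D' e l w)).
Proof.
move=> eN.
have ne : e.1 != e.2 by apply: contraTneq eN => <-.
have add i j : i != j ->
    mean P (fun w => vmax (fun l => a l + c * zeta i l w)) <=
    mean P (fun w => vmax (fun l => a l + (c * zeta i l w + c * zeta j l w))).
  move=> ij; apply: (@mean_vmax_add_centered _ _ _ P _ F p Fm FT FI Findep
    [set inl i; inr i]%SET [set inl j; inr j]%SET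
    (fun l w => c * zeta i l w) (fun l w => c * zeta j l w)) => //.
  - move=> s; rewrite !finset.in_set2 => /orP[]/eqP->;
    by rewrite ?(inj_eq inl_inj) ?(inj_eq inr_inj) (negbTE ij).
  - by move=> l; apply: measurable_funM => //; apply: smzeta; rewrite finset.in_set2 eqxx ?orbT.
  - by move=> l; apply: measurable_funM => //; apply: smzeta; rewrite finset.in_set2 eqxx ?orbT.
  - by move=> l; exact: itgZ.
  - by move=> l; exact: itgZ.
  - by move=> l; rewrite meanZ// zeta0 mulr0.
have ife l : itg P (f e l) by exact: ih.
have := edge_bound (ltW hL) ife (iS e.1) (iS e.2) (flip e) (mZ e.1) (mZ e.2)
  (ZN e.1) (ZN e.2) (SZ e.1) (SZ e.2) a.
have := add _ _ ne; have := add e.2 e.1; rewrite eq_sym => /(_ ne).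
rewrite [X in _ <= X -> _](_ : _ = mean P (fun w => vmax (fun l => a l + D' e l w))).
  rewrite [X in _ -> _ -> X <= _ -> _](_ : _ =
    mean P (fun w => vmax (fun l => a l + D e l w))).
    by rewrite -/c /zeta /D'; lra.
  by apply: eq_mean_vmax => w l; rewrite /D eN.
by apply: eq_mean_vmax => w l; rewrite /D' [X in _ + X]addrC.
Qed.

Let smf (J : {set 'I_n + 'I_n}) e l : inl e.1 \in J -> inl e.2 \in J ->
  sub_measurable F J (f e l).
Proof.
move=> i1 i2.
have smW i : inl i \in J -> sub_measurable F J (Wpair x V (g l) i).
  move=> iJ; apply: measurable_fun_pair; last exact: smS.
  by apply: measurableT_comp; [exact: measurable_snd|exact: smV].
have mW : sub_measurable F J (fun w => (Wpair x V (g l) e.1 w, Wpair x V (g l) e.2 w)).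
  by apply: measurable_fun_pair; exact: smW.
exact: (measurableT_comp (measurable_lipschitz_kernel hL hlip) mW).
Qed.

Let r q : seq ('I_n * 'I_n) :=
  [seq e <- index_enum _ | (e.2 \in N e.1) && (col e == q)].

Let r_disjoint q e e' : e \in r q -> e' \in r q -> e != e' -> ~~ share_vertex e e'.
Proof.
rewrite !mem_filter => /andP[/andP[eN /eqP ce] _] /andP[/andP[eN' /eqP ce'] _] ee'.
apply/negP => sh; have := @colP e e'; rewrite /adjacent_edges eN eN' sh.
by move=> /(_ isT ee'); rewrite ce ce' eqxx.
Qed.

(** The data ([inl]) and the Gaussians ([inr]) of both endpoints; these blocks are disjoint along a
    matching. *)
Let Je (e : 'I_n * 'I_n) : {set 'I_n + 'I_n} :=
  [set inl e.1; inr e.1; inl e.2; inr e.2]%SET.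

Let matching_step q :
  mean P (fun w => vmax (fun l => \sum_(e <- r q) D e l w)) <=
  mean P (fun w => vmax (fun l => \sum_(e <- r q) D' e l w)).
Proof.
have inJe e : [/\ inl e.1 \in Je e, inr e.1 \in Je e, inl e.2 \in Je e & inr e.2 \in Je e].
  by rewrite !finset.inE !eqxx ?orbT.
apply: (@replace_blocks _ _ _ P _ F Fm FT FI Findep p _ (r q) Je D D').
- by rewrite filter_uniq// index_enum_uniq.
- move=> e e' er er' ee' s; have := r_disjoint er er' ee'.
  rewrite /share_vertex !negb_or => /and4P[n1 n2 n3 n4].
  rewrite !finset.inE !negb_or -!orbA => /or4P[]/eqP->;
  by rewrite ?(inj_eq inl_inj) ?(inj_eq inr_inj) ?n1 ?n2 ?n3 ?n4.
- move=> e l; have [e1 _ e2 _] := inJe e; rewrite /D; case: (e.2 \in N e.1).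
    by apply: measurable_funB; [exact: smf|exact: measurable_cst].
  exact: measurable_cst.
- move=> e l; have [e1 e2 e3 e4] := inJe e.
  apply: sub_measurableD; apply: measurable_funM => //; exact: smzeta.
- move=> e l; rewrite /D; case eN: (e.2 \in N e.1); last exact: itg_cst.
  by apply: itgB; [exact: ih|exact: itg_cst].
- by move=> e l; apply: itgD; exact: itgZ.
- by move=> e a; rewrite mem_filter => /andP[/andP[eN _] _]; exact: edge_step.
Qed.

(** The degree of i within the colour class q: 0 or 1, since the class is a matching without
    loops. *)
Let b q i : nat := (\sum_(e <- r q) ((e.1 == i) + (e.2 == i)))%N.

Let b_le1 q i : (b q i <= 1)%N.
Proof.
have [/hasP[e er ei]|/hasPn H] := boolP (has (fun e => (e.1 == i) || (e.2 == i)) (r q)).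
  rewrite /b (bigD1_seq e)//=; last by rewrite filter_uniq// index_enum_uniq.
  rewrite big_seq_cond big1 ?addn0.
    have : e.1 != e.2.
      move: er; rewrite mem_filter => /andP[/andP[eN _] _].
      by apply: contraTneq eN => <-.
    case: (eqVneq e.1 i) => [E|_]; case: (eqVneq e.2 i) => [E'|_] //.
    by rewrite E E' eqxx.
  move=> e' /andP[er' ee']; have := r_disjoint er er'.
  rewrite eq_sym => /(_ ee'); rewrite /share_vertex !negb_or => /and4P[n1 n2 n3 n4].
  by case/orP: ei => /eqP <-; rewrite !(eq_sym e'.1) !(eq_sym e'.2)
    ?(negbTE n1) ?(negbTE n2) ?(negbTE n3) ?(negbTE n4).
rewrite /b big_seq big1// => e er; have := H e er; rewrite negb_or.
by move=> /andP[/negbTE-> /negbTE->].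
Qed.

Let sum_delta (j : 'I_n) (y : 'I_n -> R) : \sum_i (j == i)%:R * y i = y j.
Proof.
rewrite (bigD1 j)//= eqxx mul1r big1 ?addr0// => i ij.
by rewrite eq_sym (negbTE ij) mul0r.
Qed.

Let sumD' q l w : \sum_(e <- r q) D' e l w = \sum_i (b q i)%:R * (c * zeta i l w).
Proof.
under [RHS]eq_bigr do rewrite natr_sum mulr_suml.
rewrite exchange_big /=; apply: eq_bigr => e _.
under eq_bigr do rewrite natrD mulrDl.
by rewrite big_split /= !sum_delta.
Qed.

Let wt i : R := Num.sqrt (1 + (degree N i)%:R / k%:R).

Let wt_ge1 i : 1 <= wt i.
Proof. by rewrite -[leLHS]sqrtr1 ler_wsqrtr// lerDl divr_ge0. Qed.

Let kappa0 : 0 < kappa. Proof. exact: normal_abs_mean_gt0. Qed.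

Let c0 : 0 <= c. Proof. by rewrite mulr_ge0// divr_ge0 ?mulr_ge0// ltW. Qed.

Let gauss l w := gauss_process k x N V Z (g l) w.

Let gaussE l w : gauss l w = \sum_i wt i * zeta i l w.
Proof. by apply: eq_bigr => i _; rewrite -mulrA. Qed.

Lemma itg_gauss_process l : itg P (gauss l).
Proof.
rewrite (_ : gauss l = fun w => \sum_i wt i * zeta i l w).
  by apply: itg_sum => i _; exact: itgZ.
by apply/funext => w; exact: gaussE.
Qed.

(** A second exchange, now with one block per vertex: the weight [b q i] of the matching is raised
    to [wt i], which is at least 1, by [mean_vmax_scale]. *)
Let color_class_bound q :
  mean P (fun w => vmax (fun l => \sum_(e <- r q) D e l w)) <=
  c * mean P (fun w => vmax (gauss^~ w)).
Proof.
apply: (le_trans (matching_step q)).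
rewrite -meanZ; last by apply: itg_vmax => l; exact: itg_gauss_process.
rewrite (eq_mean_vmax _ (Y := fun l w => \sum_i (b q i)%:R * (c * zeta i l w))) => [|w l].
  2: exact: sumD'.
have -> : mean P (fun w => c * vmax (gauss^~ w)) =
    mean P (fun w => vmax (fun l => \sum_i wt i * (c * zeta i l w))).
  congr mean; apply/funext => w; rewrite -vmaxZ//; apply: eq_vmax => l.
  by rewrite gaussE mulr_sumr; apply: eq_bigr => i _; rewrite mulrCA.
pose Jv i : {set 'I_n + 'I_n} := [set inl i; inr i]%SET.
have smX (e : R) i l : sub_measurable F (Jv i) (fun w => e * (c * zeta i l w)).
  do 2 apply: measurable_funM => //.
  by apply: smzeta; rewrite finset.in_set2 eqxx ?orbT.
apply: (@replace_blocks _ _ _ P _ F Fm FT FI Findep p _ (index_enum 'I_n) Jv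
  (fun i l w => (b q i)%:R * (c * zeta i l w)) (fun i l w => wt i * (c * zeta i l w))) => //.
- exact: index_enum_uniq.
- move=> i j _ _ ij s; rewrite !finset.in_set2 => /orP[]/eqP->;
  by rewrite ?(inj_eq inl_inj) ?(inj_eq inr_inj) (negbTE ij).
- by move=> i l; do 2 apply: itgZ.
- by move=> i l; do 2 apply: itgZ.
- move=> i a _; apply: mean_vmax_scale => [|l|l].
  + by rewrite ler0n /= (le_trans _ (wt_ge1 i))// lern1 b_le1.
  + exact: itgZ.
  + by rewrite meanZ// zeta0 mulr0.
Qed.

Let centered l w := centered_stat P (Tstat k h x N V) (g l) w.

Let ite l e : e.2 \in N e.1 -> itg P (f e l). Proof. exact: ih. Qed.

Let TstatE l w : Tstat k h x N V (g l) w =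
  (n%:R * k%:R)^-1 * \sum_(e | e.2 \in N e.1) f e l w.
Proof. by congr (_ * _); rewrite pair_big_dep. Qed.

Let centered_edges l w :
  centered l w = (n%:R * k%:R)^-1 * \sum_(e | e.2 \in N e.1) D e l w.
Proof.
rewrite /centered /centered_stat.
have -> : fine 'E_P[Tstat k h x N V (g l)] = mean P (Tstat k h x N V (g l)).
  by rewrite expectation.unlock.
have -> : Tstat k h x N V (g l) =
    fun w => (n%:R * k%:R)^-1 * \sum_(e | e.2 \in N e.1) f e l w.
  by apply/funext => w'; exact: TstatE.
rewrite meanZ; last by apply: itg_sum => e eN; exact: ite.
rewrite mean_sum; last by move=> e eN; exact: ite.
rewrite -mulrBr -sumrB; congr (_ * _).
by apply: eq_bigr => e eN; rewrite /D eN.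
Qed.

Let iD e l : itg P (D e l).
Proof.
rewrite /D; case eN: (e.2 \in N e.1); last exact: itg_cst.
by apply: itgB; [exact: ite|exact: itg_cst].
Qed.

Lemma itg_centered_stat l : itg P (centered l).
Proof.
rewrite (_ : centered l = fun w =>
    (n%:R * k%:R)^-1 * \sum_(e | e.2 \in N e.1) D e l w).
  by apply: itgZ; apply: itg_sum => e _.
by apply/funext => w; exact: centered_edges.
Qed.

Lemma mean_centered_stat l : mean P (centered l) = 0.
Proof.
have iT : itg P (Tstat k h x N V (g l)).
  rewrite (_ : Tstat k h x N V (g l) = fun w =>
    (n%:R * k%:R)^-1 * \sum_(e | e.2 \in N e.1) f e l w).
    by apply: itgZ; apply: itg_sum => e eN; exact: ite.
  by apply/funext => w; exact: TstatE.
rewrite meanB// ?mean_cst; last exact: itg_cst.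
by rewrite expectation.unlock subrr.
Qed.

Let centeredE l w :
  centered l w = (n%:R * k%:R)^-1 * \sum_q \sum_(e <- r q) D e l w.
Proof.
rewrite centered_edges (partition_big col xpredT)//=; congr (_ * _).
by apply: eq_bigr => q _; rewrite big_filter.
Qed.

Lemma finite_family_bound :
  mean P (fun w => vmax (fun l => centered_stat P (Tstat k h x N V) (g l) w)) <=
  K%:R * c * (n%:R^-1 *
    mean P (fun w => vmax (fun l => gauss_process k x N V Z (g l) w))).
Proof.
have iDq q : itg P (fun w => vmax (fun l => \sum_(e <- r q) D e l w)).
  by apply: itg_vmax => l; apply: itg_sum => e _.
have nk0 : 0 <= (n%:R * k%:R)^-1 :> R by rewrite invr_ge0 mulr_ge0.
apply: (@le_trans _ _ (mean P (fun w => (n%:R * k%:R)^-1 *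
    \sum_q vmax (fun l => \sum_(e <- r q) D e l w)))).
  apply: mean_le; first by apply: itg_vmax => l; exact: itg_centered_stat.
    by apply: itgZ; exact: itg_sum.
  move=> w; rewrite (eq_vmax (centeredE^~ w)) vmaxZ// ler_wpM2l//.
  exact: vmax_sum.
rewrite meanZ; last exact: itg_sum.
rewrite mean_sum//.
apply: (@le_trans _ _ ((n%:R * k%:R)^-1 * \sum_(q < K * k) c * mean P (fun w => vmax (gauss^~ w)))).
  by rewrite ler_wpM2l// ler_sum// => q _; exact: color_class_bound.
rewrite sumr_const card_ord -[X in _ * X <= _]mulr_natl natrM.
rewrite le_eqVlt; apply/orP; left; apply/eqP; rewrite /gauss; field.
by rewrite !pnatr_eq0 -!lt0n n0 k0.
Qed.

End finite_family.

(** * Suprema *)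

Section countable_supremum.
Context d (Omega : measurableType d) (R : realType) (P : probability Omega R).
Local Open Scope ereal_scope.

Lemma countable_range (A : Type) (S : set A) (a0 : A) : countable S -> S a0 ->
  exists2 e : nat -> A, (forall n, S (e n)) & forall a, S a -> exists n, e n = a.
Proof.
move=> /countable_injP[f finj] Sa0.
pose e n := if pselect (exists2 a, S a & f a = n) is left H then sval (cid2 H) else a0.
exists e => [n|a Sa]; first by rewrite /e; case: pselect => // H; case: cid2.
exists (f a); rewrite /e; case: pselect => [H|]; last by case; exists a.
by case: (cid2 H) => b Sb fb /=; apply: finj; rewrite ?inE.
Qed.

(** Used for an empty G, whose supremum is -oo everywhere. *)
Lemma integral_cstNy : \int[P]_w (-oo) = -oo.
Proof.
have le (r : R) : \int[P]_w (-oo) <= r%:E.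
  rewrite -(mean_cst P r) meanE; last exact: itg_cst.
  by apply: le_integral_pointwise => w; exact: leNye.
case: (\int[P]_w _) le => [s le|/(_ 0%R)|//]; last by rewrite leNgt ltry.
by have := le (s - 1)%R; rewrite lee_fin lerDl oppr_ge0 ler10.
Qed.

(** Subtracting the first member from the partial maxima makes them nonnegative, as monotone
    convergence requires; the members being centered, this leaves the means unchanged. *)
Lemma integral_sup_le (A : Type) (G G0 : set A) (X : A -> Omega -> R) (B : \bar R) :
  countable G0 -> G0 `<=` G -> G !=set0 ->
  {ae P, forall w, sup_process G X w = sup_process G0 X w} ->
  (forall g, G0 g -> itg P (X g)) -> (forall g, G0 g -> mean P (X g) = 0%R) ->
  (forall p (g : 'I_p.+1 -> A), (forall l, G0 (g l)) ->
     (mean P (fun w => vmax (fun l => X (g l) w)))%:E <= B) ->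
  \int[P]_w sup_process G X w <= B.
Proof.
move=> cG0 G0G [g1 Gg1] [Nul [mNul PNul subNul]] iX X0 finB.
(* Over an empty [G0] the supremum is -oo, while over the nonempty G it never is, so the two could
   not agree almost surely. *)
have [a0 G0a0] : G0 !=set0.
  apply/set0P/negP => /eqP G00.
  have NulT : Nul = setT.
    apply/seteqP; split => // w _; apply: subNul => /=.
    rewrite G00 /sup_process image_set0 ereal_sup0 => supE.
    have : (X g1 w)%:E <= -oo by rewrite -supE; apply: ereal_sup_ubound; exists g1.
    by rewrite leeNy_eq.
  by have := PNul; rewrite NulT probability_setT => -[] /eqP; rewrite oner_eq0.
have [e eG0 eS] := countable_range cG0 G0a0.
pose M N w : R := vmax (fun l : 'I_N.+1 => X (e l) w).
have iM N : itg P (M N) by apply: itg_vmax => l; exact: iX.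
pose f N w := (M N w - X (e 0%N) w)%:E.
have f0 N w : 0 <= f N w.
  by rewrite lee_fin subr_ge0; exact: (le_vmax (fun l : 'I_N.+1 => X (e l) w) ord0).
have mf N : measurable_fun setT (f N).
  by apply/measurable_EFinP; apply: measurable_funB; [exact: itg_mf (iM N)|exact: itg_mf (iX _ _)].
have ndf w : nondecreasing_seq (f ^~ w).
  move=> i j ij; rewrite lee_fin lerD2r; apply: vmax_le => l.
  have lj : (l < j.+1)%N by rewrite (leq_trans (ltn_ord l)).
  exact: (le_vmax (fun l : 'I_j.+1 => X (e l) w) (Ordinal lj)).
pose U w := limn (f ^~ w).
have Uub N w : f N w <= U w.
  rewrite /U (cvg_lim _ (ereal_nondecreasing_cvgn (ndf w)))//.
  by apply: ereal_sup_ubound; exists N.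
have mU : measurable_fun setT U.
  by apply: (emeasurable_fun_cvg f) => // w _; exact: ereal_nondecreasing_is_cvgn.
have UB : \int[P]_w U w <= B.
  rewrite monotone_convergence//; apply: lime_le.
    apply: ereal_nondecreasing_is_cvgn => i j ij.
    by apply: ge0_le_integral => // w _; exact: ndf.
  apply: nearW => N; rewrite -[leLHS](meanE (X := fun w => (M N w - X (e 0%N) w)%R)); last first.
    by apply: itgB => //; exact: iX.
  rewrite meanB//; last exact: iX.
  by rewrite X0// subr0; apply: finB.
have supU w : sup_process G0 X w <= U w + (X (e 0%N) w)%:E.
  apply: ge_ereal_sup => _ [g G0g <-]; have [N <-] := eS _ G0g.
  rewrite -leeBlDr//; apply: le_trans (Uub N w); rewrite lee_fin lerD2r.
  exact: (le_vmax (fun l : 'I_N.+1 => X (e l) w) ord_max).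
(* A bound other than +oo makes [U] integrable, so that the subtracted member can be added back
   under the integral. *)
have [->|Boo] := eqVneq B +oo; first exact: leey.
have iU : P.-integrable setT U.
  apply/integrableP; split => //; rewrite (eq_integral U) => [|w _].
    by apply: le_lt_trans UB _; rewrite ltey.
  by rewrite gee0_abs// (le_trans (f0 0%N w)).
pose W w := U w + (X (e 0%N) w)%:E.
have mW : measurable_fun setT W.
  by apply: emeasurable_funD => //; apply/measurable_EFinP; exact: itg_mf (iX _ _).
have WB : \int[P]_w W w <= B.
  rewrite integralD//; last exact: iX.
  by rewrite -[X in _ + X]meanE ?X0 ?adde0//; exact: iX.
(* Raised to +oo on the exceptional null set, the majorant dominates at every point, as
   [le_integral_pointwise] demands for the possibly non-measurable supremum. *)
pose W' w := if w \in Nul then +oo else W w.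
have mW' : measurable_fun setT W'.
  apply: measurable_fun_ifT => //; apply: (measurable_fun_bool true).
  rewrite setTI (_ : _ @^-1` _ = Nul)//.
  by apply/seteqP; split => w /=; [exact: set_mem|exact: mem_set].
apply: (@le_trans _ _ (\int[P]_w W' w)).
  apply: le_integral_pointwise => w; rewrite /W'.
  case: ifPn => [_|wN]; first exact: leey.
  suff -> : sup_process G X w = sup_process G0 X w by exact: supU.
  apply: contrapT => wsup; move/negP: wN; apply; rewrite inE.
  exact: subNul.
rewrite (@ae_eq_integral _ _ _ P setT W)//.
exists Nul; split => // w /= /not_implyP[_ W'W]; apply: contrapT => wN; apply: W'W.
by rewrite /W' memNset.
Qed.

End countable_supremum.

Theorem theoremG1 (R : realType) (L : R) (d : nat) (hL : 0 < L)
    (hd : (1 <= d)%N) :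
  exists2 C : R, 0 < C &
  forall (n m k : nat) (x : 'I_n -> 'rV[R]_d) (N : 'I_n -> {set 'I_n})
    (G : set (m.-tuple R -> 'rV[R]_d -> R))
    (h : R * R -> R * R -> R)
    (disp : measure_display) (Omega : measurableType disp)
    (P : probability Omega R)
    (V : 'I_n -> {RV P >-> (m.-tuple R * R)%type})
    (Z : 'I_n -> {RV P >-> R}),
    (2 <= n)%N -> (1 <= m)%N -> (1 <= k)%N ->
    injective x -> knn_graph k x N ->
    lipschitz_kernel L h -> (forall w w' : R * R, h w w' = h w' w) ->
    (forall (i j : 'I_n) (A : set (m.-tuple R * R)), measurable A ->
       distribution P (V i) A = distribution P (V j) A) ->
    (forall (i : 'I_n) (B : set R), measurable B ->
       distribution P (Z i) B = normal_prob 0 1 B) ->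
    independent_systems P (fun s : 'I_n + 'I_n =>
       match s with
       | inl i => events_of (V i)
       | inr i => events_of (Z i)
       end) ->
    (forall (g : m.-tuple R -> 'rV[R]_d -> R) (i : 'I_n), G g ->
       measurable_fun setT (fun e : m.-tuple R => g e (x i))) ->
    (forall (g : m.-tuple R -> 'rV[R]_d -> R) (i : 'I_n), G g ->
       P.-integrable setT (fun w => (g (V i w).1 (x i))%:E)) ->
    (forall (g : m.-tuple R -> 'rV[R]_d -> R) (i j : 'I_n), G g -> j \in N i ->
       P.-integrable setT (fun w => (h (Wpair x V g i w) (Wpair x V g j w))%:E)) ->
    separable_process P G (centered_stat P (Tstat k h x N V)) ->
    (\int[P]_w sup_process G (centered_stat P (Tstat k h x N V)) w
       <= C%:E * ((n%:R^-1)%:E *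
            \int[P]_w sup_process G (gauss_process k x N V Z) w))%E.
Proof.
have [K K0 colK] := knn_edge_coloring hd.
have kappa0 := normal_abs_mean_gt0 R.
(* [K], which depends on d only, counts the colours per unit of k; the other factor is the scale of
   the bound for one edge. *)
pose C : R := K%:R * (2 * (4 * L / normal_abs_mean R)).
have C0 : 0 < C by rewrite !mulr_gt0 ?invr_gt0 ?ltr0n.
exists C => // n m k x N G h disp Omega P V Z n2 _ k0 xinj knn hlip _ _ ZN indep mg ig ih
  [G0 [cG0 G0G supG]].
have [->|/set0P G_ne] := eqVneq G set0.
  rewrite [leLHS](_ : _ = -oo%E) ?leNye// -[RHS](integral_cstNy P).
  by apply: eq_integral => w _; rewrite /sup_process image_set0 ereal_sup0.
have n0 : (0 < n)%N by exact: ltnW.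
have [col colP] := colK _ _ _ _ _ k0 xinj knn.
have Nirr i : i \notin N i by have [] := knn i.
apply: (integral_sup_le cG0 G0G G_ne supG) => [g /G0G Gg|g /G0G Gg|p g gG0].
(* A single function is a constant family with p = 0. *)
- by apply: (@itg_centered_stat _ _ _ _ k 0 x N h _ _ P V (fun=> g) _ ord0) => // l i j; exact: ih.
- by apply: (@mean_centered_stat _ _ _ _ k 0 x N h _ _ P V (fun=> g) _ ord0) => // l i j; exact: ih.
have Gg l : G (g l) by exact: G0G.
have mg' l i := mg (g l) i (Gg l); have ig' l i := ig (g l) i (Gg l).
have ih' l i j (ij : j \in N i) := ih (g l) i j (Gg l) ij.
apply: (@le_trans _ _ (C * (n%:R^-1 *
    mean P (fun w => vmax (fun l => gauss_process k x N V Z (g l) w))))%:E).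
  by rewrite lee_fin; apply: (finite_family_bound hL n0 k0 Nirr hlip ZN indep mg' ig' ih' colP).
rewrite !EFinM lee_pmul2l ?lte_fin//; rewrite lee_pmul2l ?lte_fin ?invr_gt0 ?ltr0n//.
rewrite meanE; last first.
  by apply: itg_vmax => l; apply: itg_gauss_process.
(* The finite maximum is attained at a member of G, hence lies below the supremum, whose
   measurability is not at stake. *)
apply: le_integral_pointwise => w; apply: ereal_sup_ubound.
have [l ->] := vmaxP (fun l => gauss_process k x N V Z (g l) w).
by exists (g l).
Qed.
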